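(* Let $a=(a_\ell)_{\ell\in\mathbb{Z}}$ be a complex valued sequence satisfying Assumption A (see context), and assume that its constant $c_3$ is positive. Then there exists a constant $C>0$ such that for any $n\in\mathbb{N}^*$, the Green's function $(\mathcal{G}_j^n)_{j\in\mathbb{Z}}$ satisfies $$\sum_{j\in\mathbb{Z},\ j-\alpha n\ge0}|\mathcal{G}_j^n|\le C\qquad\text{and}\qquad \sum_{j\in\mathbb{Z},\ j-\alpha n<0}|\mathcal{G}_j^n-\mathbb{G}_j^n|\le C,$$ where $$\mathbb{G}_j^n:=\frac1\pi\exp\left(-\frac{c_4(j-\alpha n)^2}{9c_3^2n}\right)\cos\left(\frac{2|j-\alpha n|^{3/2}}{3\sqrt{3c_3n}}-\frac\pi4\right)\int_{-\sqrt{\frac{2|j-\alpha n|}{3c_3n}}}^{\sqrt{\frac{2|j-\alpha n|}{3c_3n}}}e^{-\sqrt{3c_3n|j-\alpha n|}\,u^2}\,du .$$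
   Context: $\mathbb{N}^*=\{1,2,3,\dots\}$. For a finitely supported complex sequence $a=(a_\ell)_{\ell\in\mathbb{Z}}$, set $\widehat F_a(\theta):=\sum_{\ell\in\mathbb{Z}}a_\ell e^{i\ell\theta}$ (a trigonometric polynomial, extended holomorphically to $\theta\in\mathbb{C}$). Assumption A. The complex valued sequence $a$ is finitely supported and $\sum_{\ell}a_\ell=1$. For all $\theta\in[-\pi,\pi]\setminus\{0\}$, $|\widehat F_a(\theta)|<1$. Moreover there exist a real number $\alpha$, a nonzero real number $c_3$, a positive real number $c_4$ and a function $\varphi$ holomorphic on a neighborhood of $0$ such that, for $\theta\in\mathbb{C}$ close to $0$, $$\widehat F_a(\theta)=\exp\left(i\alpha\theta-ic_3\theta^3-c_4\theta^4+\theta^5\varphi(\theta)\right).$$ Laurent operator: $L_a$ maps a sequence $(u_j)_{j\in\mathbb{Z}}$ to $a\star u=(\sum_{\ell}a_\ell u_{j-\ell})_{j\in\mathbb{Z}}$. Green's function: $\mathcal{G}_j^n:=(L_a^n\boldsymbol{\delta})_j$ for $n\in\mathbb{N}$, $j\in\mathbb{Z}$, where $\boldsymbol{\delta}_0=1$ and $\boldsymbol{\delta}_j=0$ for $j\ne0$. *)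

(* Defs.v *)
From Stdlib Require Import Reals ZArith.
From Coquelicot Require Import Coquelicot.

Open Scope R_scope.

(** Two-sided real series; [Zseries f] is meaningful only when [ex_Zseries f]
    holds, which is automatic for finitely supported [f]. *)
Definition ex_Zseries (f : Z -> R) : Prop :=
  ex_series (fun k : nat => f (Z.of_nat k)) /\
  ex_series (fun k : nat => f (- Z.of_nat (S k))%Z).

Definition Zseries (f : Z -> R) : R :=
  Series (fun k : nat => f (Z.of_nat k)) +
  Series (fun k : nat => f (- Z.of_nat (S k))%Z).

Definition CZseries (f : Z -> C) : C :=
  (Zseries (fun l => Re (f l)), Zseries (fun l => Im (f l))).

Definition finitely_supported (a : Z -> C) : Prop :=
  exists N : Z, forall l : Z, (N < Z.abs l)%Z -> a l = RtoC 0.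

Definition Cexp (z : C) : C :=
  (exp (Re z) * cos (Im z), exp (Re z) * sin (Im z)).

Definition holomorphic_near (f : C -> C) (z0 : C) : Prop :=
  locally z0 (fun z : C => @ex_derive C_AbsRing C_NormedModule f z).

Definition Fhat (a : Z -> C) (theta : C) : C :=
  CZseries (fun l => a l * Cexp (Ci * IZR l * theta))%C.

(** The constants [alpha], [c3], [c4] are determined by [a]; they are exposed as
    parameters because they enter the definition of [approx_green]. *)
Definition assumptionA (a : Z -> C) (alpha c3 c4 : R) : Prop :=
  finitely_supported a /\
  CZseries a = RtoC 1 /\
  (forall theta : R, - PI <= theta <= PI -> theta <> 0 ->
     Cmod (Fhat a (RtoC theta)) < 1) /\
  c3 <> 0 /\
  0 < c4 /\
  exists phi : C -> C,
    holomorphic_near phi (RtoC 0) /\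
    locally (RtoC 0) (fun theta : C =>
      Fhat a theta =
      Cexp (Ci * alpha * theta - Ci * c3 * theta ^ 3 - c4 * theta ^ 4
            + theta ^ 5 * phi theta)%C).

Definition laurent (a u : Z -> C) : Z -> C :=
  fun j => CZseries (fun l => a l * u (j - l)%Z)%C.

Definition dirac (j : Z) : C := if Z.eq_dec j 0 then RtoC 1 else RtoC 0.

Definition green (a : Z -> C) (n : nat) : Z -> C :=
  Nat.iter n (laurent a) dirac.

(** The power [|x|^(3/2)] is written [sqrt (|x| ^ 3)], since [Rpower 0 (3/2)]
    is not [0]. *)
Definition approx_green (alpha c3 c4 : R) (n : nat) (j : Z) : R :=
  let x := IZR j - alpha * INR n in
  let b := sqrt (2 * Rabs x / (3 * c3 * INR n)) in
  1 / PI
  * exp (- (c4 * x ^ 2 / (9 * c3 ^ 2 * INR n)))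
  * cos (2 * sqrt (Rabs x ^ 3) / (3 * sqrt (3 * c3 * INR n)) - PI / 4)
  * RInt (fun u => exp (- (sqrt (3 * c3 * INR n * Rabs x) * u ^ 2))) (- b) b.

(* Main.v *)
Require Import Defs.
From Stdlib Require Import Reals ZArith.
From Coquelicot Require Import Coquelicot.
From Stdlib Require Import Lra Lia Psatz.

Open Scope R_scope.

(** Write x = j - alpha n. The coefficient G_j^n is (1 / 2 PI) times the integral of
    F(z)^n exp(-ijz) over any path from -PI - it to PI - it, where F is the symbol:
    this function is a trigonometric polynomial, so it has an explicit primitive.
    - On a horizontal line at depth h / n^(1/3) the cubic term of log F gives Gaussian
      decay, whence |G_j^n| <= C n^(-1/3) exp(-h x / n^(1/3)); this settles x >= 0 and
      |x| <= n^(1/3).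
    - For x < 0 let t0 = sqrt (|x| / (3 c3 n)). If t0 is small, a polygonal path crosses
      the two saddle points t0 and -t0 in their directions of steepest descent. Its
      slanted sides have length 2 sqrt(2) t0, which is the range of integration in the
      approximation, and the quadratic part of the phase gives exactly its two
      exponentials. The cubic part is odd, so it only contributes through its square,
      giving an error n^(-1/3) (|x| / n^(1/3))^(-7/4), which is summable;
      the quartic part is integrated crudely, thanks to the factor
      exp(-c4 x^2 / (9 c3^2 n)).
    - If t0 is not small, G_j^n and its approximation are both exponentially small.
    All bounds are multiples of e (1 + e |x|)^(-3/2) with e = n^(-1/3) or n^(-1/2), whose
    sums over j are bounded uniformly in e by telescoping. *)

(** * Complex exponentials and complex-valued integrals *)

(** The difficulty is uniformity in n. Put r = |x| / n^(1/3). For x < 0 and r >= 1 the approximation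
    has size about n^(-1/3) r^(-1/4), until its exponential factor cuts it off at r of order
    n^(1/6); its sum over j therefore grows with n, and only the difference with the Green's
    function can be summed. An error of first order in the cubic part of the phase would have size
    n^(-1/3) r^(-1), whose sum is still of order log n. This is why each slanted side has its saddle
    point as midpoint: the cubic term then integrates to exactly zero, and only its square is left
    to estimate. Keeping the finite range of integration makes the main term come out exactly, so
    that no Gaussian tail has to be compared. The bound |F| < 1 is given on the real axis alone.
    Away from 0, compactness and a Lipschitz estimate carry it to a thin strip; near 0 the modulus
    is read off the expansion of log F. *)

Definition is_CInt : (R -> C) -> R -> R -> C -> Prop :=
  @is_RInt (prod_NormedModule R_AbsRing R_NormedModule R_NormedModule).

Lemma is_CInt_pair (g : R -> C) p q l :
  is_RInt (fun t => Re (g t)) p q (Re l) ->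
  is_RInt (fun t => Im (g t)) p q (Im l) -> is_CInt g p q l.
Proof.
  intros H1 H2. rewrite (surjective_pairing l).
  now apply is_RInt_fct_extend_pair.
Qed.

Lemma is_CInt_Re g p q l :
  is_CInt g p q l -> is_RInt (fun t => Re (g t)) p q (Re l).
Proof. apply is_RInt_fct_extend_fst. Qed.

Lemma is_CInt_Im g p q l :
  is_CInt g p q l -> is_RInt (fun t => Im (g t)) p q (Im l).
Proof. apply is_RInt_fct_extend_snd. Qed.

Lemma is_CInt_ext (f g : R -> C) p q l :
  (forall t, f t = g t) -> is_CInt f p q l -> is_CInt g p q l.
Proof. intros H. apply is_RInt_ext. intros; apply H. Qed.

Lemma is_CInt_plus (f g : R -> C) p q k l :
  is_CInt f p q k -> is_CInt g p q l ->
  is_CInt (fun t => f t + g t)%C p q (k + l)%C.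
Proof. intros H1 H2. exact (is_RInt_plus _ _ _ _ _ _ H1 H2). Qed.

(** [is_CInt] views C as a product of real normed modules, whose scalars are real; multiplication by
    a complex constant is therefore recovered from the two components. *)
Lemma is_CInt_mult_l (c : C) (f : R -> C) p q l :
  is_CInt f p q l -> is_CInt (fun t => c * f t)%C p q (c * l)%C.
Proof.
  intros H. pose proof (is_CInt_Re _ _ _ _ H) as H1.
  pose proof (is_CInt_Im _ _ _ _ H) as H2.
  apply is_CInt_pair.
  - apply (is_RInt_ext (fun t => minus (scal (Re c) (Re (f t))) (scal (Im c) (Im (f t))))).
    + intros t _. rewrite re_mult. reflexivity.
    + rewrite re_mult.
      apply (is_RInt_minus (fun t => scal (Re c) (Re (f t))) (fun t => scal (Im c) (Im (f t))));
        apply (is_RInt_scal (V := R_NormedModule)); assumption.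
  - apply (is_RInt_ext (fun t => plus (scal (Re c) (Im (f t))) (scal (Im c) (Re (f t))))).
    + intros t _. rewrite im_mult. reflexivity.
    + rewrite im_mult.
      apply (is_RInt_plus (fun t => scal (Re c) (Im (f t))) (fun t => scal (Im c) (Re (f t))));
        apply (is_RInt_scal (V := R_NormedModule)); assumption.
Qed.

Lemma is_CInt_minus (f g : R -> C) p q k l :
  is_CInt f p q k -> is_CInt g p q l ->
  is_CInt (fun t => f t - g t)%C p q (k - l)%C.
Proof. intros H1 H2. exact (is_RInt_minus _ _ _ _ _ _ H1 H2). Qed.

Lemma is_CInt_RtoC (f : R -> R) p q l :
  is_RInt f p q l -> is_CInt (fun t => RtoC (f t)) p q (RtoC l).
Proof.
  intros H. apply is_CInt_pair; [exact H|].
  pose proof (is_RInt_const (V := R_NormedModule) p q 0) as K.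
  unfold scal in K; simpl in K; unfold mult in K; simpl in K.
  rewrite Rmult_0_r in K. exact K.
Qed.

Lemma Cmod_CInt_le (f : R -> C) (h : R -> R) p q l k :
  p <= q -> (forall t, p <= t <= q -> Cmod (f t) <= h t) ->
  is_CInt f p q l -> is_RInt h p q k -> Cmod l <= k.
Proof.
  intros Hpq H Hf Hh. rewrite Cmod_norm.
  refine (norm_RInt_le f h p q l k Hpq _ Hf Hh).
  intros t Ht. rewrite <- Cmod_norm. now apply H.
Qed.

Lemma Cexp_plus (z w : C) : Cexp (z + w)%C = (Cexp z * Cexp w)%C.
Proof.
  unfold Cexp. rewrite re_plus, im_plus, exp_plus, cos_plus, sin_plus.
  unfold Cmult; simpl; f_equal; ring.
Qed.

Lemma Cexp_0 : Cexp (RtoC 0) = RtoC 1.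
Proof. unfold Cexp; simpl. rewrite exp_0, cos_0, sin_0. unfold RtoC; f_equal; ring. Qed.

Lemma Cmod_Cexp (z : C) : Cmod (Cexp z) = exp (Re z).
Proof.
  unfold Cmod, Cexp; simpl fst; simpl snd.
  replace (_ + _) with (Rsqr (exp (Re z)) * (Rsqr (sin (Im z)) + Rsqr (cos (Im z))))
    by (unfold Rsqr; ring).
  rewrite sin2_cos2, Rmult_1_r, sqrt_Rsqr; auto using Rlt_le, exp_pos.
Qed.

Lemma Cexp_pow (z : C) (n : nat) : (Cexp z ^ n)%C = Cexp (INR n * z)%C.
Proof.
  induction n as [|n IH].
  - simpl. now rewrite Cmult_0_l, Cexp_0.
  - rewrite Cpow_S, IH, <- Cexp_plus, S_INR, RtoC_plus. f_equal. ring.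
Qed.

Lemma Cexp_2PI (k : Z) : Cexp (Ci * IZR k * RtoC (2 * PI))%C = RtoC 1.
Proof.
  unfold Cexp.
  replace (Re _) with 0 by (simpl; ring).
  replace (Im _) with (0 + 2 * IZR k * PI) by (simpl; ring).
  rewrite exp_0. unfold RtoC. f_equal.
  - assert (H : forall m, cos (0 + 2 * IZR (Z.of_nat m) * PI) = 1).
    { intros m. rewrite <- INR_IZR_INZ, cos_period. apply cos_0. }
    destruct (Z_le_gt_dec 0 k) as [Hk|Hk].
    + rewrite <- (Z2Nat.id k Hk), H; ring.
    + rewrite <- (Z.opp_involutive k), <- (Z2Nat.id (- k)) by lia.
      rewrite opp_IZR.
      replace (0 + 2 * - IZR (Z.of_nat (Z.to_nat (- k))) * PI) with
        (- (0 + 2 * IZR (Z.of_nat (Z.to_nat (- k))) * PI)) by ring.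
      rewrite cos_neg, H; ring.
  - assert (H : forall m, sin (0 + 2 * IZR (Z.of_nat m) * PI) = 0).
    { intros m. rewrite <- INR_IZR_INZ, sin_period. apply sin_0. }
    destruct (Z_le_gt_dec 0 k) as [Hk|Hk].
    + rewrite <- (Z2Nat.id k Hk), H; ring.
    + rewrite <- (Z.opp_involutive k), <- (Z2Nat.id (- k)) by lia.
      rewrite opp_IZR.
      replace (0 + 2 * - IZR (Z.of_nat (Z.to_nat (- k))) * PI) with
        (- (0 + 2 * IZR (Z.of_nat (Z.to_nat (- k))) * PI)) by ring.
      rewrite sin_neg, H; ring.
Qed.

Lemma is_CInt_Cexp (c z v : C) (p q : R) :
  is_CInt (fun t => c * v * Cexp (c * (z + RtoC t * v)))%C p q
    (Cexp (c * (z + RtoC q * v)) - Cexp (c * (z + RtoC p * v)))%C.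
Proof.
  destruct c as [c1 c2], z as [z1 z2], v as [v1 v2].
  set (A := fun t : R => c1 * (z1 + t * v1) - c2 * (z2 + t * v2)).
  set (B := fun t : R => c1 * (z2 + t * v2) + c2 * (z1 + t * v1)).
  assert (E : forall t : R, Cexp ((c1, c2) * ((z1, z2) + RtoC t * (v1, v2)))%C
    = (exp (A t) * cos (B t), exp (A t) * sin (B t))).
  { intros t. unfold Cexp, A, B.
    replace (Re _) with (c1 * (z1 + t * v1) - c2 * (z2 + t * v2)) by (simpl; ring).
    replace (Im _) with (c1 * (z2 + t * v2) + c2 * (z1 + t * v1)) by (simpl; ring).
    reflexivity. }
  apply is_CInt_ext with (f := fun t => (((c1, c2) * (v1, v2)) *
     (exp (A t) * cos (B t), exp (A t) * sin (B t))%R)%C).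
  { intros t. now rewrite E. }
  rewrite !E. unfold A, B.
  apply is_CInt_pair.
  - simpl. apply (is_RInt_derive (V := R_CompleteNormedModule)
      (fun t => exp (c1 * (z1 + t * v1) - c2 * (z2 + t * v2)) *
                cos (c1 * (z2 + t * v2) + c2 * (z1 + t * v1)))).
    + intros t _. auto_derive; [easy|]. unfold Rminus. ring.
    + intros t _. apply (ex_derive_continuous (V := R_NormedModule)).
      auto_derive; easy.
  - simpl. apply (is_RInt_derive (V := R_CompleteNormedModule)
      (fun t => exp (c1 * (z1 + t * v1) - c2 * (z2 + t * v2)) *
                sin (c1 * (z2 + t * v2) + c2 * (z1 + t * v1)))).
    + intros t _. auto_derive; [easy|]. unfold Rminus. ring.
    + intros t _. apply (ex_derive_continuous (V := R_NormedModule)).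
      auto_derive; easy.
Qed.

Lemma Cmod_le_Re_Im (z : C) : Cmod z <= Rabs (Re z) + Rabs (Im z).
Proof.
  replace z with (RtoC (Re z) + Ci * RtoC (Im z))%C at 1.
  - eapply Rle_trans; [apply Cmod_triangle|].
    rewrite Cmod_mult, Cmod_Ci, !Cmod_R; lra.
  - destruct z; unfold Ci, RtoC, Cplus, Cmult; simpl; f_equal; ring.
Qed.

Lemma im_le_Cmod (z : C) : Rabs (Im z) <= Cmod z.
Proof.
  eapply Rle_trans; [|apply Rmax_Cmod]. apply Rmax_r.
Qed.

Lemma exp_le_compat (x y : R) : x <= y -> exp x <= exp y.
Proof.
  intros [H| ->]; [left; now apply exp_increasing|right; reflexivity].
Qed.

Lemma exp_pow (x : R) (n : nat) : exp x ^ n = exp (INR n * x).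
Proof.
  induction n as [|n IH]; [simpl; now rewrite Rmult_0_l, exp_0|].
  rewrite S_INR, Rmult_plus_distr_r, exp_plus, <- IH, Rmult_1_l. simpl; ring.
Qed.

Lemma Cexp_RtoC (x : R) : Cexp (RtoC x) = RtoC (exp x).
Proof. unfold Cexp; simpl. now rewrite cos_0, sin_0, Rmult_1_r, Rmult_0_r. Qed.

Lemma exp_scaled_le (t x : R) : 0 <= t <= 1 -> exp (t * x) <= exp (Rmax 0 x).
Proof.
  intros H. apply exp_le_compat. unfold Rmax; destruct (Rle_dec 0 x); nra.
Qed.

Lemma is_CInt_segment_exp (z : C) (p q : R) :
  is_CInt (fun t => z * Cexp (RtoC t * z))%C p q
    (Cexp (RtoC q * z) - Cexp (RtoC p * z))%C.
Proof.
  generalize (is_CInt_Cexp (RtoC 1) (RtoC 0) z p q).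
  rewrite !Cplus_0_l, !Cmult_1_l. apply is_CInt_ext.
  intros t. rewrite Cplus_0_l, !Cmult_1_l. reflexivity.
Qed.

(** The difference is the integral of z exp(tz) over [0, 1]. Only the positive part of Re z enters
    the exponential, so a purely oscillating factor costs nothing. *)
Lemma Cexp_minus_1_le (z : C) :
  Cmod (Cexp z - RtoC 1)%C <= Cmod z * exp (Rmax 0 (Re z)).
Proof.
  pose proof (is_CInt_segment_exp z 0 1) as H.
  rewrite Cmult_1_l, Cmult_0_l, Cexp_0 in H.
  refine (Cmod_CInt_le _ (fun _ => Cmod z * exp (Rmax 0 (Re z))) 0 1 _ _ Rle_0_1 _ H _).
  - intros t Ht. rewrite Cmod_mult, Cmod_Cexp, re_scal_l.
    apply Rmult_le_compat_l; [apply Cmod_ge_0|now apply exp_scaled_le].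
  - generalize (is_RInt_const (V := R_NormedModule) 0 1 (Cmod z * exp (Rmax 0 (Re z)))).
    unfold scal; simpl; unfold mult; simpl. now rewrite Rminus_0_r, Rmult_1_l.
Qed.

Lemma Cexp_minus_1_minus_id_le (z : C) :
  Cmod (Cexp z - RtoC 1 - z)%C <= Cmod z ^ 2 * exp (Rmax 0 (Re z)).
Proof.
  pose proof (is_CInt_segment_exp z 0 1) as H.
  rewrite Cmult_1_l, Cmult_0_l, Cexp_0 in H.
  assert (Hc : is_CInt (fun _ => z) 0 1 z).
  { generalize (is_CInt_mult_l z _ 0 1 _ (is_CInt_RtoC _ 0 1 _
      (is_RInt_const (V := R_NormedModule) 0 1 1))).
    unfold scal; simpl; unfold mult; simpl. rewrite Rminus_0_r, !Rmult_1_r, !Cmult_1_r.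
    apply is_CInt_ext. reflexivity. }
  pose proof (is_CInt_minus _ _ _ _ _ _ H Hc) as K.
  refine (Cmod_CInt_le _ (fun _ => Cmod z ^ 2 * exp (Rmax 0 (Re z))) 0 1 _ _ Rle_0_1 _ K _).
  - intros t Ht.
    replace (z * Cexp (RtoC t * z) - z)%C with (z * (Cexp (RtoC t * z) - RtoC 1))%C by ring.
    rewrite Cmod_mult.
    replace (Cmod z ^ 2 * exp (Rmax 0 (Re z))) with
      (Cmod z * (Cmod z * exp (Rmax 0 (Re z)))) by ring.
    apply Rmult_le_compat_l; [apply Cmod_ge_0|].
    eapply Rle_trans; [apply Cexp_minus_1_le|].
    rewrite Cmod_mult, Cmod_R, re_scal_l, Rabs_pos_eq by lra.
    pose proof (Cmod_ge_0 z).
    apply Rmult_le_compat; [nra|apply Rlt_le, exp_pos|nra|].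
    apply exp_le_compat. unfold Rmax.
    destruct (Rle_dec 0 (t * Re z)), (Rle_dec 0 (Re z)); nra.
  - generalize (is_RInt_const (V := R_NormedModule) 0 1 (Cmod z ^ 2 * exp (Rmax 0 (Re z)))).
    unfold scal; simpl; unfold mult; simpl. now rewrite Rminus_0_r, Rmult_1_l.
Qed.

(** * Contour integrals of trigonometric polynomials *)

Fixpoint csum (h : nat -> C) (n : nat) : C :=
  match n with
  | O => h O
  | S m => (csum h m + h (S m))%C
  end.

(** The index k is paired with -(k+1), as in [Zseries]. The sum thus runs from -(n+1) to n, and its
    extra index falls where [g] vanishes whenever [CZseries_finite] applies. *)
Definition zsum (g : Z -> C) (n : nat) : C :=
  csum (fun k => g (Z.of_nat k) + g (- Z.of_nat (S k))%Z)%C n.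

Lemma Series_eventually_0 (u : nat -> R) (n : nat) :
  (forall k, (n < k)%nat -> u k = 0) -> Series u = sum_n u n.
Proof.
  intros H. apply is_series_unique.
  apply (is_lim_seq_ext_loc (fun _ => sum_n u n) (sum_n u) (Finite (sum_n u n))).
  - exists n. intros m Hm. induction Hm as [|m Hm IH]; [reflexivity|].
    rewrite sum_Sn, <- IH, (H (S m)) by lia.
    symmetry; apply Rplus_0_r.
  - apply is_lim_seq_const.
Qed.

Lemma CZseries_finite (g : Z -> C) (n : nat) :
  (forall l, (Z.of_nat n < Z.abs l)%Z -> g l = RtoC 0) -> CZseries g = zsum g n.
Proof.
  intros H. unfold CZseries, Zseries.
  rewrite !(Series_eventually_0 _ n);
    try (intros k Hk; rewrite H by lia; reflexivity).
  unfold zsum. clear H. induction n as [|n IH].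
  - rewrite !sum_O. simpl csum. unfold Cplus. reflexivity.
  - rewrite !sum_Sn. cbn [csum]. rewrite <- IH. unfold plus; simpl.
    unfold Cplus; simpl. unfold Re, Im. f_equal; ring.
Qed.

(** [Q] is a primitive of [g] along every straight segment, equal to m z plus a periodic function.
    Integrals along the sides of a polygon then telescope, which stands in for Cauchy's theorem; the
    property passes to sums and multiples, hence from exponentials to trigonometric polynomials. *)
Definition has_mean (g : C -> C) (m : C) : Prop :=
  exists Q : C -> C,
    (forall z, Q (z + RtoC (2 * PI))%C = (Q z + RtoC (2 * PI) * m)%C) /\
    (forall z v p q, is_CInt (fun t => v * g (z + RtoC t * v))%C p q
                       (Q (z + RtoC q * v) - Q (z + RtoC p * v))%C).

Lemma has_mean_ext (f g : C -> C) (m : C) :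
  (forall z, f z = g z) -> has_mean f m -> has_mean g m.
Proof.
  intros E [Q [H1 H2]]. exists Q. split; [exact H1|].
  intros z v p q. eapply is_CInt_ext; [|apply H2].
  intros t; simpl. now rewrite E.
Qed.

Lemma has_mean_plus (f g : C -> C) (l m : C) :
  has_mean f l -> has_mean g m -> has_mean (fun z => f z + g z)%C (l + m)%C.
Proof.
  intros [P [P1 P2]] [Q [Q1 Q2]]. exists (fun z => P z + Q z)%C. split.
  - intros z. rewrite P1, Q1. ring.
  - intros z v p q.
    replace (P (z + RtoC q * v) + Q (z + RtoC q * v) -
             (P (z + RtoC p * v) + Q (z + RtoC p * v)))%C with
      (P (z + RtoC q * v) - P (z + RtoC p * v) +
       (Q (z + RtoC q * v) - Q (z + RtoC p * v)))%C by ring.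
    eapply is_CInt_ext; [|exact (is_CInt_plus _ _ _ _ _ _ (P2 z v p q) (Q2 z v p q))].
    intros t; simpl. ring.
Qed.

Lemma has_mean_mult (c : C) (f : C -> C) (m : C) :
  has_mean f m -> has_mean (fun z => c * f z)%C (c * m)%C.
Proof.
  intros [Q [Q1 Q2]]. exists (fun z => c * Q z)%C. split.
  - intros z. rewrite Q1. ring.
  - intros z v p q.
    replace (c * Q (z + RtoC q * v) - c * Q (z + RtoC p * v))%C with
      (c * (Q (z + RtoC q * v) - Q (z + RtoC p * v)))%C by ring.
    eapply is_CInt_ext; [|exact (is_CInt_mult_l c _ _ _ _ (Q2 z v p q))].
    intros t; simpl. ring.
Qed.

Lemma has_mean_csum (h : nat -> C -> C) (m : nat -> C) (n : nat) :
  (forall k, has_mean (h k) (m k)) ->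
  has_mean (fun z => csum (fun k => h k z) n) (csum m n).
Proof.
  intros H. induction n as [|n IH]; simpl; [apply H|].
  now apply has_mean_plus.
Qed.

(** The primitive exp(ikz) / (ik) is periodic, except for k = 0, where the primitive z gains 2 PI
    over a period. *)
Lemma has_mean_Cexp (k : Z) :
  has_mean (fun z => Cexp (Ci * IZR k * z)%C) (dirac k).
Proof.
  unfold dirac. destruct (Z.eq_dec k 0) as [->|Hk].
  - exists (fun z => z). split; [intros z; ring|].
    intros z v p q.
    apply is_CInt_ext with (f := fun t => (v * RtoC 1)%C).
    + intros t. f_equal. rewrite Cmult_0_r, Cmult_0_l. now rewrite Cexp_0.
    + generalize (is_CInt_mult_l v _ p q _ (is_CInt_RtoC _ p q _
        (is_RInt_const (V := R_NormedModule) p q 1))).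
      unfold scal; simpl; unfold mult; simpl. rewrite Rmult_1_r, RtoC_minus.
      replace (z + RtoC q * v - (z + RtoC p * v))%C with (v * (RtoC q - RtoC p))%C by ring.
      easy.
  - assert (Hc : (Ci * RtoC (IZR k))%C <> RtoC 0).
    { apply Cmult_neq_0; [exact Ci_nz|]. intros E. apply RtoC_inj in E.
      now apply eq_IZR in E. }
    exists (fun z => / (Ci * RtoC (IZR k)) * Cexp (Ci * IZR k * z))%C. split.
    + intros z. rewrite Cmult_plus_distr_l, Cexp_plus, Cexp_2PI. ring.
    + intros z v p q.
      replace (_ - _)%C with (/ (Ci * RtoC (IZR k)) *
        (Cexp (Ci * IZR k * (z + RtoC q * v)) - Cexp (Ci * IZR k * (z + RtoC p * v))))%C
        by ring.
      eapply is_CInt_ext;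
        [|exact (is_CInt_mult_l (/ (Ci * RtoC (IZR k)))%C _ p q _
                   (is_CInt_Cexp (Ci * RtoC (IZR k))%C z v p q))].
      intros t; simpl. field. split; [|exact Ci_nz].
      intros E. apply Hc. rewrite E; ring.
Qed.

Definition supported_in (a : Z -> C) (N : nat) : Prop :=
  forall l : Z, (Z.of_nat N < Z.abs l)%Z -> a l = RtoC 0.

Lemma finitely_supported_in a : finitely_supported a -> exists N, supported_in a N.
Proof.
  intros [N HN]. exists (Z.to_nat N). intros l Hl. apply HN. lia.
Qed.

Lemma Fhat_zsum a N theta : supported_in a N ->
  Fhat a theta = zsum (fun l => a l * Cexp (Ci * IZR l * theta))%C N.
Proof.
  intros H. apply CZseries_finite. intros l Hl. rewrite H by exact Hl. ring.
Qed.

(** Fourier inversion by induction on n: since exp(-i(j-l)z) = exp(ilz) exp(-ijz), one more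
    convolution with [a] multiplies the integrand by the symbol. *)
Lemma has_mean_green a N n : supported_in a N -> forall j : Z,
  has_mean (fun z => Fhat a z ^ n * Cexp (- (Ci * IZR j * z)))%C (green a n j).
Proof.
  intros Ha. induction n as [|n IH]; intros j.
  - change (green a 0 j) with (dirac j).
    replace (dirac j) with (dirac (- j)).
    + eapply has_mean_ext; [|apply has_mean_Cexp].
      intros z; simpl. rewrite Cmult_1_l, opp_IZR, RtoC_opp. f_equal; ring.
    + unfold dirac. destruct (Z.eq_dec (- j) 0), (Z.eq_dec j 0); try lia; reflexivity.
  - change (green a (S n) j) with (laurent a (green a n) j).
    unfold laurent. rewrite (CZseries_finite _ N)
      by (intros l Hl; rewrite Ha by exact Hl; ring).
    unfold zsum.
    assert (Hl : forall l, has_mean (fun z => a l * Cexp (Ci * IZR l * z) *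
        (Fhat a z ^ n * Cexp (- (Ci * IZR j * z))))%C (a l * green a n (j - l))%C).
    { intros l. eapply has_mean_ext; [|apply (has_mean_mult (a l) _ _ (IH (j - l)%Z))].
      intros z; simpl. rewrite minus_IZR, RtoC_minus.
      replace (- (Ci * (RtoC (IZR j) - RtoC (IZR l)) * z))%C with
        (Ci * RtoC (IZR l) * z + - (Ci * RtoC (IZR j) * z))%C by ring.
      rewrite Cexp_plus. ring. }
    eapply has_mean_ext;
      [|apply (has_mean_csum (fun k z =>
          a (Z.of_nat k) * Cexp (Ci * IZR (Z.of_nat k) * z) *
            (Fhat a z ^ n * Cexp (- (Ci * IZR j * z))) +
          a (- Z.of_nat (S k))%Z * Cexp (Ci * IZR (- Z.of_nat (S k)) * z) *
            (Fhat a z ^ n * Cexp (- (Ci * IZR j * z))))%C);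
        intros k; apply has_mean_plus; apply Hl].
    intros z. cbv beta.
    set (e := (Fhat a z ^ n * Cexp (- (Ci * IZR j * z)))%C).
    replace (Fhat a z ^ S n * Cexp (- (Ci * IZR j * z)))%C with (Fhat a z * e)%C
      by (unfold e; rewrite Cpow_S; ring).
    clearbody e.
    rewrite (Fhat_zsum a N z Ha). unfold zsum.
    clear. induction N as [|N IHN]; cbn [csum]; [ring|].
    rewrite IHN. ring.
Qed.

(** On the strip each exponential is Lipschitz, with a constant controlled by exp |l|, and there are
    finitely many of them. This is what carries |F| < 1 from the real axis to nearby horizontal
    lines. *)
Lemma Fhat_lipschitz a N : supported_in a N ->
  exists L, 0 <= L /\ forall z w, Rabs (Im z) <= 1 -> Cmod w <= 1 ->
    Cmod (Fhat a (z + w) - Fhat a z)%C <= L * Cmod w.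
Proof.
  intros Ha.
  assert (Hl : forall l, exists L, 0 <= L /\
    forall z w, Rabs (Im z) <= 1 -> Cmod w <= 1 ->
      Cmod (a l * Cexp (Ci * IZR l * (z + w)) - a l * Cexp (Ci * IZR l * z))%C
        <= L * Cmod w).
  { intros l. pose proof (exp_pos (Rabs (IZR l))) as He.
    pose proof (Cmod_ge_0 (a l)) as Hal. pose proof (Rabs_pos (IZR l)) as Hl.
    exists (Cmod (a l) * exp (Rabs (IZR l)) * (Rabs (IZR l) * exp (Rabs (IZR l)))).
    split; [repeat apply Rmult_le_pos; lra|]. intros z w Hz Hw.
    rewrite Cmult_plus_distr_l, Cexp_plus.
    replace (_ - _)%C with (a l * Cexp (Ci * IZR l * z) *
      (Cexp (Ci * IZR l * w) - RtoC 1))%C by ring.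
    rewrite !Cmod_mult, Cmod_Cexp, !Rmult_assoc.
    apply Rmult_le_compat_l; [exact Hal|].
    apply Rmult_le_compat;
      [apply Rlt_le, exp_pos|apply Cmod_ge_0| |].
    - apply exp_le_compat.
      replace (Re _) with (- (IZR l * Im z))
        by (destruct z; simpl; ring).
      eapply Rle_trans; [apply Rle_abs|]. rewrite Rabs_Ropp, Rabs_mult.
      pose proof (Rabs_pos (Im z)). nra.
    - eapply Rle_trans; [apply Cexp_minus_1_le|].
      rewrite !Cmod_mult, Cmod_Ci, Cmod_R, Rmult_1_l.
      replace (Rabs (IZR l) * (exp (Rabs (IZR l)) * Cmod w)) with
        (Rabs (IZR l) * Cmod w * exp (Rabs (IZR l))) by ring.
      apply Rmult_le_compat_l; [apply Rmult_le_pos; [lra|apply Cmod_ge_0]|].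
      apply exp_le_compat, Rmax_lub; [lra|].
      replace (Re _) with (- (IZR l * Im w)) by (destruct w; simpl; ring).
      eapply Rle_trans; [apply Rle_abs|]. rewrite Rabs_Ropp, Rabs_mult.
      pose proof (im_le_Cmod w). pose proof (Rabs_pos (Im w)). nra. }
  assert (H : forall n, exists L, 0 <= L /\
    forall z w, Rabs (Im z) <= 1 -> Cmod w <= 1 ->
      Cmod (zsum (fun l => a l * Cexp (Ci * IZR l * (z + w))) n -
            zsum (fun l => a l * Cexp (Ci * IZR l * z)) n)%C <= L * Cmod w).
  { assert (Hp : forall k : nat, exists L, 0 <= L /\
      forall z w, Rabs (Im z) <= 1 -> Cmod w <= 1 ->
      Cmod ((a (Z.of_nat k) * Cexp (Ci * IZR (Z.of_nat k) * (z + w)) +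
             a (- Z.of_nat (S k))%Z * Cexp (Ci * IZR (- Z.of_nat (S k)) * (z + w))) -
            (a (Z.of_nat k) * Cexp (Ci * IZR (Z.of_nat k) * z) +
             a (- Z.of_nat (S k))%Z * Cexp (Ci * IZR (- Z.of_nat (S k)) * z)))%C
        <= L * Cmod w).
    { intros k. destruct (Hl (Z.of_nat k)) as [L1 [P1 H1]].
      destruct (Hl (- Z.of_nat (S k))%Z) as [L2 [P2 H2]].
      exists (L1 + L2). split; [lra|]. intros z w Hz Hw.
      specialize (H1 z w Hz Hw). specialize (H2 z w Hz Hw).
      match type of H1 with Cmod ?x <= _ => match type of H2 with Cmod ?y <= _ =>
        replace (_ - _)%C with (x + y)%C by ring end end.
      eapply Rle_trans; [apply Cmod_triangle|]. lra. }
    unfold zsum. intros n. induction n as [|n IH]; cbn [csum]; [apply Hp|].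
    destruct IH as [L1 [P1 H1]]. destruct (Hp (S n)) as [L2 [P2 H2]].
    exists (L1 + L2). split; [lra|]. intros z w Hz Hw.
    specialize (H1 z w Hz Hw). specialize (H2 z w Hz Hw).
    match type of H1 with Cmod ?x <= _ => match type of H2 with Cmod ?y <= _ =>
      replace (_ - _)%C with (x + y)%C by ring end end.
    eapply Rle_trans; [apply Cmod_triangle|]. lra. }
  destruct (H N) as [L [HL1 HL2]]. exists L. split; [exact HL1|].
  intros z w Hz Hw. rewrite !(Fhat_zsum a N _ Ha). now apply HL2.
Qed.

(** * Integrals under Gaussian bounds *)

Lemma is_RInt_inv_1_plus_sqr (k p q : R) : 0 < k ->
  is_RInt (fun u => / (1 + k * u ^ 2)) p q
    (atan (sqrt k * q) / sqrt k - atan (sqrt k * p) / sqrt k).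
Proof.
  intros Hk. pose proof (sqrt_lt_R0 k Hk) as Hs.
  assert (E : sqrt k ^ 2 = k) by (apply pow2_sqrt; lra).
  apply (is_RInt_derive (V := R_CompleteNormedModule) (fun u => atan (sqrt k * u) / sqrt k)).
  - intros u _. auto_derive; [easy|].
    replace (1 + k * u ^ 2) with (1 + (sqrt k * u) ^ 2)
      by (rewrite Rpow_mult_distr, E; ring).
    pose proof (pow2_ge_0 (sqrt k * u)). field. split; [lra|].
    simpl in *; lra.
  - intros u _. apply (ex_derive_continuous (V := R_NormedModule)).
    auto_derive. pose proof (pow2_ge_0 u). nra.
Qed.

(** The Gaussian is dominated by 1 / (1 + k u^2), whose arctangent primitive gives PI / sqrt k on
    every interval, with the same power of k as the Gaussian integral. *)
Lemma Cmod_CInt_gauss (f : R -> C) (p q : R) (l : C) (M k : R) :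
  0 < k -> 0 <= M -> p <= q ->
  (forall u, p <= u <= q -> Cmod (f u) <= M * exp (- (k * u ^ 2))) ->
  is_CInt f p q l -> Cmod l <= M * (PI / sqrt k).
Proof.
  intros Hk HM Hpq Hf Hl.
  pose proof (is_RInt_scal (V := R_NormedModule) _ p q M _ (is_RInt_inv_1_plus_sqr k p q Hk)) as H.
  eapply Rle_trans.
  - refine (Cmod_CInt_le f _ p q l _ Hpq _ Hl H).
    intros u Hu. eapply Rle_trans; [apply Hf, Hu|].
    unfold scal; simpl; unfold mult; simpl.
    apply Rmult_le_compat_l; [exact HM|]. rewrite exp_Ropp.
    pose proof (pow2_ge_0 u).
    apply Rinv_le_contravar; [simpl in *; nra|].
    pose proof (exp_ineq1_le (k * u ^ 2)). simpl in *; lra.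
  - unfold scal; simpl; unfold mult; simpl.
    apply Rmult_le_compat_l; [exact HM|].
    pose proof (sqrt_lt_R0 k Hk) as Hs.
    unfold Rdiv. rewrite <- Rmult_minus_distr_r.
    apply Rmult_le_compat_r; [left; now apply Rinv_0_lt_compat|].
    pose proof (atan_bound (sqrt k * q)). pose proof (atan_bound (sqrt k * p)). lra.
Qed.

(** * Modulus of the symbol *)

Definition log_symbol (alpha c3 c4 : R) (phi : C -> C) (theta : C) : C :=
  (Ci * alpha * theta - Ci * c3 * theta ^ 3 - c4 * theta ^ 4 + theta ^ 5 * phi theta)%C.

Definition local_form (a : Z -> C) (alpha c3 c4 r K : R) (phi : C -> C) : Prop :=
  forall theta, Cmod theta < r ->
    Cmod (phi theta) <= K /\ Fhat a theta = Cexp (log_symbol alpha c3 c4 phi theta).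

(** Differentiability of [phi] at 0 gives continuity there, hence a bound K on a disc; the radius r
    and the bound K are what the estimates use. *)
Lemma assumptionA_local_form a alpha c3 c4 : assumptionA a alpha c3 c4 ->
  exists r K phi, 0 < r /\ 0 <= K /\ local_form a alpha c3 c4 r K phi.
Proof.
  intros (_ & _ & _ & _ & _ & phi & Hphi & [r1 H1]).
  pose proof (locally_singleton _ _ Hphi) as Hd.
  pose proof (ex_derive_continuous phi (RtoC 0) Hd) as Hc.
  assert (Hb : locally (RtoC 0) (fun z => Cmod (phi z) <= Cmod (phi (RtoC 0)) + 1)).
  { apply locally_C.
    apply (filter_imp (fun z => ball_norm (phi (RtoC 0)) (mkposreal 1 Rlt_0_1) (phi z))).
    - intros z Hz. unfold ball_norm in Hz.
      change (Cmod (phi z - phi (RtoC 0))%C < 1) in Hz.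
      replace (phi z) with (phi z - phi (RtoC 0) + phi (RtoC 0))%C by ring.
      eapply Rle_trans; [apply Cmod_triangle|lra].
    - apply Hc. apply (locally_ball_norm (phi (RtoC 0)) (mkposreal 1 Rlt_0_1)). }
  destruct Hb as [r2 H2].
  exists (Rmin r1 r2), (Cmod (phi (RtoC 0)) + 1), phi.
  split; [|split].
  - apply Rmin_pos; apply cond_pos.
  - pose proof (Cmod_ge_0 (phi (RtoC 0))); lra.
  - intros z Hz.
    assert (Hball : forall r : posreal, Cmod z < r -> ball (RtoC 0) r z).
    { intros r Hr. apply C_NormedModule_mixin_compat1.
      change (Cmod (z - RtoC 0)%C < r).
      replace (z - RtoC 0)%C with z by ring. exact Hr. }
    split.
    + apply H2, Hball. eapply Rlt_le_trans; [exact Hz|apply Rmin_r].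
    + apply H1, Hball. eapply Rlt_le_trans; [exact Hz|apply Rmin_l].
Qed.

Lemma pow5_sum_le (x y : R) : 0 <= x -> 0 <= y -> (x + y) ^ 5 <= 32 * (x ^ 5 + y ^ 5).
Proof.
  intros Hx Hy.
  assert (H : (x + y) ^ 5 <= (2 * Rmax x y) ^ 5).
  { apply pow_incr. pose proof (Rmax_l x y). pose proof (Rmax_r x y). lra. }
  eapply Rle_trans; [exact H|]. rewrite Rpow_mult_distr.
  pose proof (pow_le x 5 Hx). pose proof (pow_le y 5 Hy).
  unfold Rmax; destruct (Rle_dec x y); lra.
Qed.

(** At theta = s + it the real part of -i c3 theta^3 is c3 (3 s^2 t - t^3), and the drift
    contributes -alpha t, cancelled by the exponential factor on the left. For c3 > 0 the sign of t
    decides whether the cubic term helps or hurts, hence separate bounds below and above the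
    axis. *)
Lemma Cmod_symbol_near_0 a alpha c3 c4 r K phi :
  local_form a alpha c3 c4 r K phi -> forall s t : R, Rabs s + Rabs t < r ->
  Cmod (Fhat a (s, t)) * exp (alpha * t) <=
    exp (c3 * (3 * s ^ 2 * t - t ^ 3) - c4 * (s ^ 4 - 6 * s ^ 2 * t ^ 2 + t ^ 4)
         + 32 * K * (Rabs s ^ 5 + Rabs t ^ 5)).
Proof.
  intros H s t Hst.
  assert (Hm : Cmod (s, t) <= Rabs s + Rabs t) by apply (Cmod_le_Re_Im (s, t)).
  destruct (H (s, t)) as [HK HF]; [lra|].
  rewrite HF, Cmod_Cexp, <- exp_plus. apply exp_le_compat.
  unfold log_symbol. rewrite re_plus.
  replace (Re (_ - _)%C) with
    (- alpha * t + c3 * (3 * s ^ 2 * t - t ^ 3) - c4 * (s ^ 4 - 6 * s ^ 2 * t ^ 2 + t ^ 4))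
    by (simpl; ring).
  assert (Hr : Re ((s, t) ^ 5 * phi (s, t))%C <= 32 * K * (Rabs s ^ 5 + Rabs t ^ 5)).
  { eapply Rle_trans; [apply Rle_abs|]. eapply Rle_trans; [apply re_le_Cmod|].
    rewrite Cmod_mult, Cmod_pow.
    replace (32 * K * (Rabs s ^ 5 + Rabs t ^ 5)) with
      ((32 * (Rabs s ^ 5 + Rabs t ^ 5)) * K) by ring.
    apply Rmult_le_compat; [apply pow_le, Cmod_ge_0|apply Cmod_ge_0| |exact HK].
    eapply Rle_trans; [apply pow_incr; split; [apply Cmod_ge_0|exact Hm]|].
    apply pow5_sum_le; apply Rabs_pos. }
  lra.
Qed.

Lemma lipschitz_continuity (f : R -> R) (L : R) : 0 <= L ->
  (forall s h, Rabs h <= 1 -> Rabs (f (s + h) - f s) <= L * Rabs h) -> continuity f.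
Proof.
  intros HL H s e He.
  exists (Rmin 1 (e / (L + 1))). split.
  - apply Rmin_pos; [lra|]. apply Rdiv_lt_0_compat; lra.
  - intros x [_ Hx]. unfold dist in *; simpl in *; unfold R_dist in *.
    replace x with (s + (x - s)) at 1 by ring.
    pose proof (Rmin_l 1 (e / (L + 1))). pose proof (Rmin_r 1 (e / (L + 1))).
    eapply Rle_lt_trans; [apply H; lra|].
    assert (Rabs (x - s) * (L + 1) < e).
    { apply (Rmult_lt_reg_r (/ (L + 1))); [apply Rinv_0_lt_compat; lra|].
      rewrite Rmult_assoc, Rinv_r, Rmult_1_r by lra. unfold Rdiv in *. lra. }
    pose proof (Rabs_pos (x - s)). nra.
Qed.

(** By compactness |F| is at most some m < 1 at the real points with s0 <= |s| <= PI. The rate kappa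
    = -ln((1+m)/2) gives away half of the gap 1 - m, which pays for leaving the axis by at most
    t0. *)
Lemma Cmod_symbol_away a alpha c3 c4 s0 : assumptionA a alpha c3 c4 -> 0 < s0 <= PI ->
  exists kappa t0, 0 < kappa /\ 0 < t0 /\ forall s t, s0 <= Rabs s <= PI -> Rabs t <= t0 ->
    Cmod (Fhat a (s, t)) * exp (alpha * t) <= exp (- kappa).
Proof.
  intros (Hfin & _ & Hlt & _) [Hs0 Hs0'].
  destruct (finitely_supported_in a Hfin) as [N HN].
  destruct (Fhat_lipschitz a _ HN) as [L [HL HLip]].
  assert (Hc : continuity (fun s : R => Cmod (Fhat a (RtoC s)))).
  { apply lipschitz_continuity with L; [exact HL|]. intros s h Hh.
    assert (Hz : Rabs (Im (RtoC s)) <= 1) by (simpl; rewrite Rabs_R0; lra).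
    assert (Hw : Cmod (RtoC h) <= 1) by (rewrite Cmod_R; exact Hh).
    specialize (HLip (RtoC s) (RtoC h) Hz Hw). rewrite Cmod_R in HLip.
    rewrite RtoC_plus. set (x := Fhat a (RtoC s + RtoC h)%C) in *.
    set (y := Fhat a (RtoC s)) in *. eapply Rle_trans; [|exact HLip].
    pose proof (Cmod_triangle (x - y) y) as T1.
    pose proof (Cmod_triangle (y - x) x) as T2.
    replace (x - y + y)%C with x in T1 by ring.
    replace (y - x + x)%C with y in T2 by ring.
    replace (y - x)%C with (- (x - y))%C in T2 by ring. rewrite Cmod_opp in T2.
    apply Rabs_le; lra. }
  assert (Hm : exists m, 0 <= m < 1 /\
    forall s, s0 <= Rabs s <= PI -> Cmod (Fhat a (RtoC s)) <= m).
  { pose proof PI_RGT_0.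
    destruct (continuity_ab_maj _ s0 PI Hs0' (fun c _ => Hc c)) as [x1 [H1 H1']].
    destruct (continuity_ab_maj _ (- PI) (- s0) ltac:(lra) (fun c _ => Hc c)) as [x2 [H2 H2']].
    exists (Rmax (Cmod (Fhat a (RtoC x1))) (Cmod (Fhat a (RtoC x2)))). split; [split|].
    - eapply Rle_trans; [apply Cmod_ge_0|apply Rmax_l].
    - apply Rmax_lub_lt; apply Hlt; lra.
    - intros s Hs. unfold Rabs in Hs. destruct (Rcase_abs s).
      + eapply Rle_trans; [apply H2; lra|apply Rmax_r].
      + eapply Rle_trans; [apply H1; lra|apply Rmax_l]. }
  destruct Hm as [m [Hm1 Hm2]].
  (* For |t| <= 1 the product (m + L |t|) (1 + |t| |alpha| exp |alpha|) is at most m + B |t|. *)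
  set (B := L + (m + L) * (Rabs alpha * exp (Rabs alpha))).
  assert (Ha : 0 <= Rabs alpha * exp (Rabs alpha)).
  { apply Rmult_le_pos; [apply Rabs_pos|apply Rlt_le, exp_pos]. }
  assert (HB : 0 <= B).
  { unfold B. apply Rplus_le_le_0_compat; [exact HL|].
    apply Rmult_le_pos; lra. }
  exists (- ln ((1 + m) / 2)), (Rmin 1 ((1 - m) / 2 / (B + 1))).
  split; [|split].
  - assert (ln ((1 + m) / 2) < ln 1) by (apply ln_increasing; lra).
    rewrite ln_1 in *; lra.
  - apply Rmin_pos; [lra|]. apply Rdiv_lt_0_compat; lra.
  - intros s t Hs Ht. rewrite Ropp_involutive, exp_ln by lra.
    assert (Ht1 : Rabs t <= 1) by (eapply Rle_trans; [exact Ht|apply Rmin_l]).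
    assert (Ht2 : Rabs t * (B + 1) <= (1 - m) / 2).
    { apply (Rmult_le_reg_r (/ (B + 1))); [apply Rinv_0_lt_compat; lra|].
      rewrite Rmult_assoc, Rinv_r, Rmult_1_r by lra.
      eapply Rle_trans; [exact Ht|apply Rmin_r]. }
    pose proof (Rabs_pos t) as Ht0.
    assert (HF : Cmod (Fhat a (s, t)) <= m + L * Rabs t).
    { assert (Hz : Rabs (Im (RtoC s)) <= 1) by (simpl; rewrite Rabs_R0; lra).
      assert (Hw : Cmod (Ci * RtoC t)%C = Rabs t)
        by (rewrite Cmod_mult, Cmod_Ci, Cmod_R; ring).
      specialize (HLip (RtoC s) (Ci * RtoC t)%C Hz ltac:(lra)). rewrite Hw in HLip.
      replace (RtoC s + Ci * RtoC t)%C with ((s, t) : C) in HLip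
        by (unfold RtoC, Ci, Cplus, Cmult; simpl; f_equal; ring).
      specialize (Hm2 s Hs).
      replace (Fhat a (s, t)) with
        (Fhat a (s, t) - Fhat a (RtoC s) + Fhat a (RtoC s))%C by ring.
      eapply Rle_trans; [apply Cmod_triangle|lra]. }
    assert (He : exp (alpha * t) <= 1 + Rabs t * (Rabs alpha * exp (Rabs alpha))).
    { pose proof (Cexp_minus_1_le (RtoC (Rabs alpha * Rabs t))) as H.
      pose proof (Rabs_pos alpha).
      rewrite Cmod_R, Rabs_mult, !Rabs_Rabsolu in H.
      rewrite Cexp_RtoC, <- RtoC_minus, Cmod_R in H.
      assert (Hx : exp (Rmax 0 (Re (RtoC (Rabs alpha * Rabs t)))) <= exp (Rabs alpha)).
      { apply exp_le_compat, Rmax_lub; [lra|simpl; nra]. }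
      assert (H3 : exp (alpha * t) <= exp (Rabs alpha * Rabs t)).
      { apply exp_le_compat. rewrite <- Rabs_mult. apply Rle_abs. }
      pose proof (Rle_abs (exp (Rabs alpha * Rabs t) - 1)).
      assert (Rabs alpha * Rabs t * exp (Rmax 0 (Re (RtoC (Rabs alpha * Rabs t))))
        <= Rabs alpha * Rabs t * exp (Rabs alpha)).
      { apply Rmult_le_compat_l; [nra|exact Hx]. }
      lra. }
    eapply Rle_trans.
    + apply Rmult_le_compat; [apply Cmod_ge_0|apply Rlt_le, exp_pos|exact HF|exact He].
    + set (q := Rabs alpha * exp (Rabs alpha)) in *.
      assert (L * Rabs t * (Rabs t * q) <= L * (Rabs t * q)).
      { rewrite Rmult_assoc. apply Rmult_le_compat_l; [exact HL|].
        assert (0 <= Rabs t * q) by (apply Rmult_le_pos; lra). nra. }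
      unfold B in Ht2. nra.
Qed.

Lemma Rle_Rmin (x y z : R) : x <= Rmin y z -> x <= y /\ x <= z.
Proof.
  intros H. split; (eapply Rle_trans; [exact H|]); [apply Rmin_l|apply Rmin_r].
Qed.

(* Moving the contour into the lower half plane turns the dispersive cubic
   term into Gaussian decay. *)
Lemma Cmod_symbol_below a alpha c3 c4 : assumptionA a alpha c3 c4 -> 0 < c3 ->
  exists h0, 0 < h0 <= 1 /\ forall s h, Rabs s <= PI -> 0 <= h <= h0 ->
    Cmod (Fhat a (s, - h)) * exp (alpha * - h) <= exp (2 * c3 * h ^ 3 - 2 * c3 * h * s ^ 2).
Proof.
  intros HA Hc3.
  assert (Hc4 : 0 < c4) by apply HA.
  destruct (assumptionA_local_form _ _ _ _ HA) as (r & K & phi & Hr & HK & Hloc).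
  pose proof PI_RGT_0 as HPI. pose proof PI2_1 as HPI1.
  set (s0 := Rmin 1 (Rmin (r / 2) (c4 / (32 * (K + 1))))).
  assert (Hs01 : s0 <= 1) by apply Rmin_l.
  assert (Hs0r : s0 <= r / 2) by (eapply Rle_trans; [apply Rmin_r|apply Rmin_l]).
  assert (Hs0c : s0 <= c4 / (32 * (K + 1))) by (eapply Rle_trans; [apply Rmin_r|apply Rmin_r]).
  assert (Hs0 : 0 < s0).
  { repeat apply Rmin_pos; try lra. apply Rdiv_lt_0_compat; lra. }
  destruct (Cmod_symbol_away a alpha c3 c4 s0 HA) as (kappa & t0 & Hk & Ht0 & Haway);
    [lra|].
  (* After 1, the bounds serve in turn to stay in the disc of the expansion, to stay in the strip of
     the bound away from 0, to pay the cross term 6 c4 s^2 h^2 with one third of the decay 3 c3 h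
     s^2, to absorb the quintic remainder in h into c3 h^3, and to keep 2 c3 h PI^2 <= kappa. The
     choice of [s0] lets c4 s^4 absorb the quintic remainder in s. *)
  set (h0 := Rmin 1 (Rmin (r / 3) (Rmin t0 (Rmin (c3 / (6 * c4))
               (Rmin (c3 / (32 * (K + 1))) (kappa / (2 * c3 * PI ^ 2))))))).
  assert (Hpos : 0 < h0).
  { assert (0 < PI ^ 2) by (apply pow_lt; lra).
    repeat apply Rmin_pos; try lra; apply Rdiv_lt_0_compat; nra. }
  exists h0. split; [split; [exact Hpos|apply Rmin_l]|].
  intros s h Hs [Hh0 Hh].
  destruct (Rle_Rmin _ _ _ Hh) as [T1 Hh1].
  destruct (Rle_Rmin _ _ _ Hh1) as [T2 Hh2].
  destruct (Rle_Rmin _ _ _ Hh2) as [T3 Hh3].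
  destruct (Rle_Rmin _ _ _ Hh3) as [T4 Hh4].
  destruct (Rle_Rmin _ _ _ Hh4) as [T5 T6].
  assert (D : forall x y z, 0 < z -> x <= y / z -> x * z <= y).
  { intros x y z Hz Hx. apply (Rmult_le_compat_r z) in Hx; [|lra].
    unfold Rdiv in Hx. rewrite Rmult_assoc, Rinv_l, Rmult_1_r in Hx by lra. exact Hx. }
  apply D in T4; [|lra]. apply D in T5; [|lra].
  apply D in T6; [|assert (0 < PI ^ 2) by (apply pow_lt; lra); nra].
  apply D in Hs0c; [|lra].
  assert (Hss : s ^ 2 = Rabs s ^ 2) by apply (eq_sym (pow2_abs s)).
  destruct (Rlt_le_dec (Rabs s) s0) as [Hss0|Hss0].
  - eapply Rle_trans; [apply (Cmod_symbol_near_0 _ _ _ _ _ _ _ Hloc)|].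
    + rewrite Rabs_Ropp, (Rabs_pos_eq h) by lra. lra.
    + apply exp_le_compat. rewrite Rabs_Ropp, (Rabs_pos_eq h) by lra.
      replace (s ^ 4) with (Rabs s ^ 4) by (replace (Rabs s ^ 4) with ((Rabs s ^ 2) ^ 2) by ring;
        rewrite <- Hss; ring).
      rewrite Hss. set (v := Rabs s) in *.
      assert (Hv : 0 <= v) by apply Rabs_pos.
      assert (E1 : 32 * K * v ^ 5 <= c4 * v ^ 4).
      { assert (0 <= v ^ 4) by (apply pow_le; lra).
        replace (32 * K * v ^ 5) with (32 * K * v * v ^ 4) by ring.
        apply Rmult_le_compat_r; [lra|]. nra. }
      assert (E2 : 32 * K * h ^ 5 <= c3 * h ^ 3).
      { assert (0 <= h ^ 3) by (apply pow_le; lra).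
        replace (32 * K * h ^ 5) with (32 * K * h ^ 2 * h ^ 3) by ring.
        apply Rmult_le_compat_r; [lra|]. nra. }
      assert (E3 : c4 * (6 * v ^ 2 * h ^ 2) <= c3 * h * v ^ 2).
      { assert (0 <= v ^ 2) by (apply pow_le; lra).
        replace (c4 * (6 * v ^ 2 * h ^ 2)) with (h * (6 * c4) * (h * v ^ 2)) by ring.
        replace (c3 * h * v ^ 2) with (c3 * (h * v ^ 2)) by ring.
        apply Rmult_le_compat_r; [nra|lra]. }
      assert (E4 : 0 <= c4 * h ^ 4) by (apply Rmult_le_pos; [lra|apply pow_le; lra]).
      nra.
  - eapply Rle_trans; [apply Haway; [lra|]|].
    + rewrite Rabs_Ropp, Rabs_pos_eq; lra.
    + apply exp_le_compat. rewrite Hss.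
      assert (Hv : Rabs s ^ 2 <= PI ^ 2) by (apply pow_incr; split; [apply Rabs_pos|lra]).
      assert (0 <= c3 * h ^ 3) by (apply Rmult_le_pos; [lra|apply pow_le; lra]).
      assert (2 * c3 * h * Rabs s ^ 2 <= 2 * c3 * h * PI ^ 2).
      { apply Rmult_le_compat_l; nra. }
      lra.
Qed.

(** Above the axis the cubic term 3 c3 s^2 t has the wrong sign; completing a square, the quartic
    term c4 s^4 dominates it at the price 9 c3^2 t^2 / c4. The loss is quadratic in t, so where |x|
    is at least a multiple of n on the left, a small t gains t |x| and loses only n B t^2. *)
Lemma Cmod_symbol_above a alpha c3 c4 : assumptionA a alpha c3 c4 -> 0 < c3 ->
  exists t0 B, 0 < t0 /\ 0 <= B /\ forall s t, Rabs s <= PI -> 0 <= t <= t0 ->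
    Cmod (Fhat a (s, t)) * exp (alpha * t) <= exp (B * t ^ 2).
Proof.
  intros HA Hc3.
  assert (Hc4 : 0 < c4) by apply HA.
  destruct (assumptionA_local_form _ _ _ _ HA) as (r & K & phi & Hr & HK & Hloc).
  pose proof PI_RGT_0 as HPI. pose proof PI2_1 as HPI1.
  set (s0 := Rmin 1 (Rmin (r / 2) (c4 / (64 * (K + 1))))).
  assert (Hs01 : s0 <= 1) by apply Rmin_l.
  assert (Hs0r : s0 <= r / 2) by (eapply Rle_trans; [apply Rmin_r|apply Rmin_l]).
  assert (Hs0c : s0 <= c4 / (64 * (K + 1))) by (eapply Rle_trans; [apply Rmin_r|apply Rmin_r]).
  assert (Hs0 : 0 < s0).
  { repeat apply Rmin_pos; try lra. apply Rdiv_lt_0_compat; lra. }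
  destruct (Cmod_symbol_away a alpha c3 c4 s0 HA) as (kappa & t0 & Hk & Ht0 & Haway);
    [lra|].
  assert (HB1 : 0 <= 9 * c3 ^ 2 / c4).
  { apply Rmult_le_pos; [pose proof (pow2_ge_0 c3); lra|].
    left; now apply Rinv_0_lt_compat. }
  exists (Rmin 1 (Rmin (r / 3) t0)), (9 * c3 ^ 2 / c4 + 6 * c4 + 32 * K).
  split; [repeat apply Rmin_pos; lra|]. split; [lra|].
  intros s t Hs [Ht1 Ht2].
  pose proof (Rmin_l 1 (Rmin (r / 3) t0)). pose proof (Rmin_r 1 (Rmin (r / 3) t0)).
  pose proof (Rmin_l (r / 3) t0). pose proof (Rmin_r (r / 3) t0).
  assert (Hss : s ^ 2 = Rabs s ^ 2) by apply (eq_sym (pow2_abs s)).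
  destruct (Rlt_le_dec (Rabs s) s0) as [Hss0|Hss0].
  - eapply Rle_trans; [apply (Cmod_symbol_near_0 _ _ _ _ _ _ _ Hloc)|].
    + rewrite (Rabs_pos_eq t) by lra. lra.
    + apply exp_le_compat. rewrite (Rabs_pos_eq t) by lra.
      replace (s ^ 4) with (Rabs s ^ 4) by (replace (Rabs s ^ 4) with ((Rabs s ^ 2) ^ 2) by ring;
        rewrite <- Hss; ring).
      rewrite Hss. set (v := Rabs s) in *.
      assert (Hv : 0 <= v) by apply Rabs_pos.
      assert (Hs0c' : s0 * (64 * (K + 1)) <= c4).
      { apply (Rmult_le_compat_r (64 * (K + 1))) in Hs0c; [|lra].
        unfold Rdiv in Hs0c. rewrite Rmult_assoc, Rinv_l, Rmult_1_r in Hs0c by lra.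
        exact Hs0c. }
      assert (E1 : 64 * K * v ^ 5 <= c4 * v ^ 4).
      { assert (0 <= v ^ 4) by (apply pow_le; lra).
        replace (64 * K * v ^ 5) with (64 * K * v * v ^ 4) by ring.
        apply Rmult_le_compat_r; [lra|]. nra. }
      assert (E2 : K * t ^ 5 <= K * t ^ 2).
      { apply Rmult_le_compat_l; [lra|]. replace (t ^ 5) with (t ^ 2 * t ^ 3) by ring.
        rewrite <- (Rmult_1_r (t ^ 2)) at 2.
        apply Rmult_le_compat_l; [apply pow2_ge_0|].
        rewrite <- (pow1 3). apply pow_incr; lra. }
      assert (E3 : c4 * (v ^ 2 * t ^ 2) <= c4 * t ^ 2).
      { apply Rmult_le_compat_l; [lra|]. rewrite <- (Rmult_1_l (t ^ 2)) at 2.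
        apply Rmult_le_compat_r; [apply pow2_ge_0|].
        rewrite <- (pow1 2). apply pow_incr; lra. }
      assert (E4 : 0 <= c4 * t ^ 4) by (apply Rmult_le_pos; [lra|apply pow_le; lra]).
      assert (E5 : 0 <= c3 * t ^ 3) by (apply Rmult_le_pos; [lra|apply pow_le; lra]).
      assert (E6 : 3 * c3 * v ^ 2 * t <= c4 / 4 * v ^ 4 + 9 * c3 ^ 2 / c4 * t ^ 2).
      { apply Rminus_le. replace (_ - _) with
          (- (c4 / 4 * (v ^ 2 - 6 * c3 * t / c4) ^ 2)) by (field; lra).
        pose proof (pow2_ge_0 (v ^ 2 - 6 * c3 * t / c4)). nra. }
      assert (E7 : 0 <= c4 * v ^ 4) by (apply Rmult_le_pos; [lra|apply pow_le; lra]).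
      lra.
  - eapply Rle_trans; [apply Haway; [lra|]|].
    + rewrite Rabs_pos_eq; lra.
    + apply exp_le_compat. pose proof (pow2_ge_0 t). nra.
Qed.

(** * The contour *)

Definition integrand (a : Z -> C) (n : nat) (j : Z) (z : C) : C :=
  (Fhat a z ^ n * Cexp (- (Ci * IZR j * z)))%C.

Lemma Cmod_integrand a n j alpha s t :
  Cmod (integrand a n j (s, t)) =
    (Cmod (Fhat a (s, t)) * exp (alpha * t)) ^ n * exp ((IZR j - alpha * INR n) * t).
Proof.
  unfold integrand. rewrite Cmod_mult, Cmod_pow, Cmod_Cexp, Rpow_mult_distr.
  rewrite Rmult_assoc. f_equal.
  replace (Re _) with (INR n * (alpha * t) + (IZR j - alpha * INR n) * t) by (simpl; ring).
  now rewrite exp_plus, exp_pow.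
Qed.

Lemma green_line a N n j t M k :
  supported_in a N -> 0 < k -> 0 <= M ->
  (forall s, Rabs s <= PI -> Cmod (integrand a n j (s, t)) <= M * exp (- (k * s ^ 2))) ->
  Cmod (green a n j) <= M / sqrt k.
Proof.
  intros Ha Hk HM H. pose proof PI_RGT_0 as HPI.
  destruct (has_mean_green a N n Ha j) as [Q [HQ1 HQ2]].
  specialize (HQ2 (0, t) (RtoC 1) (- PI) PI).
  replace (((0, t) : C) + RtoC PI * RtoC 1)%C with
    (((0, t) : C) + RtoC (- PI) * RtoC 1 + RtoC (2 * PI))%C in HQ2
    by (unfold RtoC, Cplus, Cmult; simpl; f_equal; ring).
  rewrite HQ1 in HQ2.
  replace (_ - _)%C with (RtoC (2 * PI) * green a n j)%C in HQ2 by ring.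
  assert (B : Cmod (RtoC (2 * PI) * green a n j)%C <= M * (PI / sqrt k)).
  { refine (Cmod_CInt_gauss _ (- PI) PI _ M k Hk HM _ _ HQ2); [lra|].
    intros u Hu. rewrite Cmult_1_l.
    replace (((0, t) : C) + RtoC u * RtoC 1)%C with ((u, t) : C)
      by (unfold RtoC, Cplus, Cmult; simpl; f_equal; ring).
    apply H, Rabs_le; lra. }
  rewrite Cmod_mult, Cmod_R, Rabs_pos_eq in B by lra.
  pose proof (Cmod_ge_0 (green a n j)). pose proof (sqrt_lt_R0 k Hk).
  apply (Rmult_le_reg_l PI); [lra|].
  replace (PI * (M / sqrt k)) with (M * (PI / sqrt k)) by (field; lra).
  nra.
Qed.

(* Unit direction of steepest descent, [exp (- sigma * i * PI / 4)], of the phase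
   at the saddle point [sigma * t0]. *)
Definition descent_dir (sigma : R) : C := (sqrt 2 / 2, - sigma * (sqrt 2 / 2)).

(** Writing w for the direction of descent, the point is sigma (t0 + u w), so both sides share one
    expansion. For sigma = -1 the side is run from i t0 down to -2 t0 - i t0, against the contour;
    the weight w, which is sigma times the velocity sigma w, restores the orientation. *)
Definition slanted_integrand a n j t0 sigma (u : R) : C :=
  (descent_dir sigma *
   integrand a n j (RtoC (sigma * t0) + RtoC u * (RtoC sigma * descent_dir sigma)))%C.

(* The contour runs through -PI - i t0, -2 t0 - i t0, i t0, 2 t0 - i t0 and
   PI - i t0; its two slanted sides pass through the saddle points -t0 and t0. *)
Lemma green_contour a N n j t0 : supported_in a N ->
  exists Il Dl Dr Ir,
    is_CInt (fun s => integrand a n j (s, - t0)) (- PI) (- (2 * t0)) Il /\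
    is_CInt (slanted_integrand a n j t0 (- 1)) (- (sqrt 2 * t0)) (sqrt 2 * t0) Dl /\
    is_CInt (slanted_integrand a n j t0 1) (- (sqrt 2 * t0)) (sqrt 2 * t0) Dr /\
    is_CInt (fun s => integrand a n j (s, - t0)) (2 * t0) PI Ir /\
    (RtoC (2 * PI) * green a n j = Il + Dl + Dr + Ir)%C.
Proof.
  intros Ha. destruct (has_mean_green a N n Ha j) as [Q [HQ1 HQ2]].
  fold (integrand a n j) in HQ2.
  assert (Hh : forall p q, is_CInt (fun s => integrand a n j (s, - t0)) p q
    (Q (q, - t0)%R - Q (p, - t0)%R)%C).
  { intros p q. pose proof (HQ2 (0, - t0) (RtoC 1) p q) as H.
    assert (E : forall s, (((0, - t0)%R : C) + RtoC s * RtoC 1)%C = ((s, - t0)%R : C))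
      by (intros s; unfold RtoC, Cplus, Cmult; simpl; f_equal; ring).
    rewrite !E in H. eapply is_CInt_ext; [|exact H].
    intros s; simpl. fold (integrand a n j (((0, - t0)%R : C) + RtoC s * RtoC 1)%C).
    rewrite E. ring. }
  assert (E2 : sqrt 2 * sqrt 2 = 2) by (apply sqrt_sqrt; lra).
  assert (Hs : forall sigma, sigma * sigma = 1 ->
    is_CInt (slanted_integrand a n j t0 sigma) (- (sqrt 2 * t0)) (sqrt 2 * t0)
      (RtoC sigma * (Q (2 * sigma * t0, - t0)%R - Q (0, t0)%R))%C).
  { intros sigma Hsig.
    pose proof (HQ2 (RtoC (sigma * t0)) (RtoC sigma * descent_dir sigma)%C
      (- (sqrt 2 * t0)) (sqrt 2 * t0)) as H.
    replace (RtoC (sigma * t0) + RtoC (sqrt 2 * t0) * (RtoC sigma * descent_dir sigma))%C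
      with ((2 * sigma * t0, - t0)%R : C) in H.
    2:{ unfold RtoC, descent_dir, Cplus, Cmult; simpl; f_equal.
        - transitivity (sigma * t0 * (1 + sqrt 2 * sqrt 2 / 2)); [rewrite E2; field|field].
        - transitivity (- (sigma * sigma) * t0 * (sqrt 2 * sqrt 2 / 2));
            [rewrite E2, Hsig; field|field]. }
    replace (RtoC (sigma * t0) + RtoC (- (sqrt 2 * t0)) * (RtoC sigma * descent_dir sigma))%C
      with ((0, t0)%R : C) in H.
    2:{ unfold RtoC, descent_dir, Cplus, Cmult; simpl; f_equal.
        - transitivity (sigma * t0 * (1 - sqrt 2 * sqrt 2 / 2)); [rewrite E2; field|field].
        - transitivity ((sigma * sigma) * t0 * (sqrt 2 * sqrt 2 / 2));
            [rewrite E2, Hsig; field|field]. }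
    eapply is_CInt_ext; [|exact (is_CInt_mult_l (RtoC sigma) _ _ _ _ H)].
    intros u; cbv beta. unfold slanted_integrand, integrand.
    set (e := (Fhat _ _ ^ n * _)%C).
    transitivity (RtoC (sigma * sigma) * (descent_dir sigma * e))%C;
      [rewrite RtoC_mult; ring|rewrite Hsig; ring]. }
  do 4 eexists. split; [apply Hh|]. split; [apply Hs; ring|].
  split; [apply Hs; ring|]. split; [apply Hh|].
  pose proof (HQ1 (- PI, - t0)) as HP.
  replace (((- PI, - t0)%R : C) + RtoC (2 * PI))%C with ((PI, - t0)%R : C) in HP
    by (unfold RtoC, Cplus; simpl; f_equal; ring).
  rewrite HP.
  replace (2 * -1 * t0) with (- (2 * t0)) by ring.
  replace (2 * 1 * t0) with (2 * t0) by ring.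
  replace (RtoC (-1)) with (- RtoC 1)%C by exact (eq_sym (RtoC_opp 1)). ring.
Qed.

(** * Expansion at the saddle points *)

Lemma pow3_le_exp (t : R) : 0 <= t -> t ^ 3 <= 27 * exp t.
Proof.
  intros Ht. replace (exp t) with (exp (t / 3) ^ 3).
  - replace (27 * exp (t / 3) ^ 3) with ((3 * exp (t / 3)) ^ 3) by ring.
    apply pow_incr. pose proof (exp_ineq1_le (t / 3)). lra.
  - simpl. rewrite Rmult_1_r, <- !exp_plus. f_equal; lra.
Qed.

Lemma descent_dir_sqr sigma : sigma * sigma = 1 ->
  (descent_dir sigma * descent_dir sigma = - (Ci * RtoC sigma))%C.
Proof.
  intros H. assert (E2 : sqrt 2 * sqrt 2 = 2) by (apply sqrt_sqrt; lra).
  unfold descent_dir, RtoC, Ci, Cmult, Copp; simpl; f_equal.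
  - transitivity ((1 - sigma * sigma) * (sqrt 2 * sqrt 2 / 4)); [field|rewrite H; ring].
  - transitivity (- sigma * (sqrt 2 * sqrt 2 / 2)); [field|rewrite E2; field].
Qed.

Lemma Cmod_descent_dir sigma : sigma * sigma = 1 -> Cmod (descent_dir sigma) = 1.
Proof.
  intros H. assert (E2 : sqrt 2 * sqrt 2 = 2) by (apply sqrt_sqrt; lra).
  unfold Cmod, descent_dir; simpl fst; simpl snd.
  rewrite <- sqrt_1. f_equal.
  transitivity ((1 + sigma * sigma) * (sqrt 2 * sqrt 2 / 4)); [field|rewrite H, E2; field].
Qed.

(* Exponent of the integrand at the saddle point and its quadratic, cubic and
   remaining parts along the direction of steepest descent. *)
Lemma saddle_expansion (alpha c3 c4 n j t0 sigma u : R) (w p : C) :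
  (w * w = - (Ci * RtoC sigma))%C -> sigma * sigma = 1 ->
  j - alpha * n = - (3 * c3 * n * t0 ^ 2) ->
  let th := (RtoC (sigma * t0) + RtoC u * (RtoC sigma * w))%C in
  (RtoC n * (Ci * alpha * th - Ci * c3 * th ^ 3 - c4 * th ^ 4 + th ^ 5 * p)
     + - (Ci * RtoC j * th) =
   RtoC (2 * sigma * (c3 * n * t0 ^ 3)) * Ci + RtoC (- (c4 * n * t0 ^ 4))
   + RtoC (- (3 * (n * c3 * t0) * u ^ 2))
   + - (RtoC (n * c3 * u ^ 3) * w)
   + RtoC n * (th ^ 5 * p - c4 * (th ^ 4 - RtoC t0 ^ 4)))%C.
Proof.
  intros Hw Hs Hj th.
  (* The relation between j and t0 makes t0 and -t0 critical points of the cubic phase, so the terms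
     linear in u cancel in the last [ring]. As w^2 = -i sigma, the quadratic coefficient becomes
     real and negative. *)
  assert (Ej : RtoC j = (RtoC alpha * RtoC n - RtoC 3 * RtoC c3 * RtoC n * RtoC t0 ^ 2)%C).
  { replace j with (alpha * n - 3 * c3 * n * t0 ^ 2) by lra.
    rewrite RtoC_minus, !RtoC_mult, RtoC_pow. reflexivity. }
  assert (Es : (RtoC sigma * RtoC sigma = RtoC 1)%C) by now rewrite <- RtoC_mult, Hs.
  assert (Ei : (Ci * Ci = - RtoC 1)%C)
    by (unfold Ci, RtoC, Cmult, Copp; simpl; f_equal; ring).
  assert (Eth : th = (RtoC sigma * (RtoC t0 + RtoC u * w))%C)
    by (unfold th; rewrite RtoC_mult; ring).
  assert (Eth3 : (th ^ 3 = RtoC sigma * (RtoC t0 ^ 3 + RtoC 3 * RtoC t0 ^ 2 * RtoC u * w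
      + RtoC 3 * RtoC t0 * RtoC u ^ 2 * (w * w) + RtoC u ^ 3 * (w * w) * w))%C).
  { transitivity (RtoC sigma * (RtoC sigma * RtoC sigma) * (RtoC t0 + RtoC u * w) ^ 3)%C;
      [rewrite Eth; ring|rewrite Es; ring]. }
  rewrite Hw in Eth3.
  assert (Ei3 : (Ci * th ^ 3 = Ci * RtoC sigma * (RtoC t0 ^ 3 + RtoC 3 * RtoC t0 ^ 2 * RtoC u * w)
      + RtoC 3 * RtoC t0 * RtoC u ^ 2 + RtoC u ^ 3 * w)%C).
  { rewrite Eth3.
    transitivity (Ci * RtoC sigma * (RtoC t0 ^ 3 + RtoC 3 * RtoC t0 ^ 2 * RtoC u * w)
      - (Ci * Ci) * (RtoC sigma * RtoC sigma) * (RtoC 3 * RtoC t0 * RtoC u ^ 2 + RtoC u ^ 3 * w))%C;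
      [ring|rewrite Ei, Es; ring]. }
  rewrite !RtoC_opp, !RtoC_mult, !RtoC_pow, Ej.
  replace (RtoC n * (Ci * alpha * th - Ci * c3 * th ^ 3 - c4 * th ^ 4 + th ^ 5 * p)
     + - (Ci * (RtoC alpha * RtoC n - RtoC 3 * RtoC c3 * RtoC n * RtoC t0 ^ 2) * th))%C
    with (RtoC 3 * RtoC c3 * RtoC n * RtoC t0 ^ 2 * Ci * th - RtoC n * RtoC c3 * (Ci * th ^ 3)
      + RtoC n * (th ^ 5 * p - c4 * th ^ 4))%C by ring.
  rewrite Ei3. replace (Ci * th)%C with (Ci * (RtoC sigma * (RtoC t0 + RtoC u * w)))%C
    by now rewrite Eth.
  rewrite <- (Cmult_assoc _ Ci th).
  replace (Ci * th)%C with (Ci * (RtoC sigma * (RtoC t0 + RtoC u * w)))%C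
    by now rewrite Eth.
  ring.
Qed.

(** * Slanted sides of the contour *)

Lemma is_RInt_cube_gauss (k b : R) : 0 < k ->
  is_RInt (fun u => u ^ 3 * exp (- (k * u ^ 2))) (- b) b 0.
Proof.
  intros Hk.
  pose (P := fun u : R => - (u ^ 2 / (2 * k) + / (2 * k ^ 2)) * exp (- (k * u ^ 2))).
  replace 0 with (minus (P b) (P (- b))).
  - apply (is_RInt_derive (V := R_CompleteNormedModule) P).
    + intros u _. unfold P. auto_derive; [easy|]. simpl. field. lra.
    + intros u _. apply (ex_derive_continuous (V := R_NormedModule)).
      auto_derive; easy.
  - unfold P. replace ((- b) ^ 2) with (b ^ 2) by ring.
    apply Rminus_diag_eq. reflexivity.
Qed.

(** With |v| <= 2 t0 the binomial terms add up to 4 + 12 + 16 + 8 = 40. *)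
Lemma Cmod_pow4_diff (t0 : R) (v : C) : 0 <= t0 -> Cmod v <= 2 * t0 ->
  Cmod ((RtoC t0 + v) ^ 4 - RtoC t0 ^ 4)%C <= 40 * t0 ^ 3 * Cmod v.
Proof.
  intros Ht Hv.
  replace ((RtoC t0 + v) ^ 4 - RtoC t0 ^ 4)%C with
    (v * ((RtoC (4 * t0 ^ 3) + RtoC (6 * t0 ^ 2) * v) + (RtoC (4 * t0) * v ^ 2 + v ^ 3)))%C
    by (rewrite !RtoC_mult, !RtoC_pow; ring).
  pose proof (Cmod_ge_0 v) as Hv0.
  rewrite Cmod_mult, Rmult_comm. apply Rmult_le_compat_r; [exact Hv0|].
  assert (Hp2 : Cmod v ^ 2 <= (2 * t0) ^ 2) by (apply pow_incr; lra).
  assert (Hp3 : Cmod v ^ 3 <= (2 * t0) ^ 3) by (apply pow_incr; lra).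
  assert (0 <= t0 ^ 2) by apply pow2_ge_0.
  assert (0 <= t0 ^ 3) by (apply pow_le; lra).
  eapply Rle_trans; [apply Cmod_triangle|].
  eapply Rle_trans; [apply Rplus_le_compat; apply Cmod_triangle|].
  rewrite !Cmod_mult, !Cmod_pow, !Cmod_R, !Rabs_pos_eq by lra.
  assert (6 * t0 ^ 2 * Cmod v <= 6 * t0 ^ 2 * (2 * t0)) by (apply Rmult_le_compat_l; lra).
  assert (4 * t0 * Cmod v ^ 2 <= 4 * t0 * (2 * t0) ^ 2) by (apply Rmult_le_compat_l; lra).
  lra.
Qed.

(* The cubic term [A] is kept to first order: being odd, it integrates to zero. *)
Lemma Cmod_exp_perturbation (A E : C) (x y : R) :
  Re A <= x -> 0 <= x -> Cmod E <= y ->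
  Cmod (Cexp (A + E) - RtoC 1 - A)%C <= exp x * (Cmod A ^ 2 + Cmod E * exp y).
Proof.
  intros HA Hx HE. rewrite Cexp_plus.
  replace (Cexp A * Cexp E - RtoC 1 - A)%C with
    ((Cexp A - RtoC 1 - A) + Cexp A * (Cexp E - RtoC 1))%C by ring.
  eapply Rle_trans; [apply Cmod_triangle|].
  rewrite Cmod_mult, Cmod_Cexp, Rmult_plus_distr_l.
  apply Rplus_le_compat.
  - eapply Rle_trans; [apply Cexp_minus_1_minus_id_le|].
    rewrite Rmult_comm. apply Rmult_le_compat_r; [apply pow2_ge_0|].
    apply exp_le_compat, Rmax_lub; assumption.
  - apply Rmult_le_compat; [apply Rlt_le, exp_pos|apply Cmod_ge_0|now apply exp_le_compat|].
    eapply Rle_trans; [apply Cexp_minus_1_le|].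
    apply Rmult_le_compat_l; [apply Cmod_ge_0|].
    apply exp_le_compat, Rmax_lub.
    + pose proof (Cmod_ge_0 E); lra.
    + eapply Rle_trans; [|exact HE]. eapply Rle_trans; [apply Rle_abs|apply re_le_Cmod].
Qed.

(** The first term comes from the square of the cubic part, the second from the quartic and quintic
    parts, which keep half of the exponent c4 n t0^4; the last factor bounds the integral of the
    remaining Gaussian exp(-n c3 t0 u^2). *)
Definition slanted_error (c3 c4 K n t0 : R) : R :=
  (27 / (c3 * n * t0 ^ 3)
   + K * exp (- (c4 / 2 * (n * t0 ^ 4))) * (n * (t0 ^ 3 / sqrt (n * c3 * t0) + t0 ^ 5)))
  * (PI / sqrt (n * c3 * t0)).

(** A budget of exponentials. With X = n c3 t0 u^2 and Y = c4 n t0^4 / 2, the available weight is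
    exp(-3X - 2Y). The growth of the cubic factor costs exp(X), and bounding its square by a
    constant costs exp(X) more. For the quartic and quintic parts, the exponential costs exp(X/2 +
    Y) and the modulus exp(X/2). In both cases exp(-X) is left to integrate. *)
Lemma slanted_estimate a alpha c3 c4 : assumptionA a alpha c3 c4 -> 0 < c3 ->
  exists d K, 0 < d /\ 0 <= K /\
  forall sigma n j t0 D J, sigma * sigma = 1 -> (1 <= n)%nat -> 0 < t0 <= d ->
    IZR j - alpha * INR n = - (3 * c3 * INR n * t0 ^ 2) ->
    is_CInt (slanted_integrand a n j t0 sigma) (- (sqrt 2 * t0)) (sqrt 2 * t0) D ->
    is_RInt (fun u => exp (- (3 * (INR n * c3 * t0) * u ^ 2)))
      (- (sqrt 2 * t0)) (sqrt 2 * t0) J ->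
    Cmod (D - RtoC (exp (- (c4 * INR n * t0 ^ 4)) * J) *
       (descent_dir sigma * Cexp (RtoC (2 * sigma * (c3 * INR n * t0 ^ 3)) * Ci)))%C
    <= slanted_error c3 c4 K (INR n) t0.
Proof.
  intros HA Hc3.
  assert (Hc4 : 0 < c4) by apply HA.
  destruct (assumptionA_local_form _ _ _ _ HA) as (r & K0 & phi & Hr & HK0 & Hloc).
  (* 243 = 3^5 comes from |th| <= 3 t0 on the side. [K2] is the coefficient of n t0^5 after a square
     is completed in u; t0 <= c4 / (2 K2) turns that term into half of the quartic decay, and t0 <=
     r / 4 keeps the side in the disc of the expansion. *)
  set (K1 := 40 * c4 + 243 * K0).
  assert (HK1 : 0 < K1) by (unfold K1; lra).
  set (K2 := K1 ^ 2 / (2 * c3) + K1).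
  assert (HK2 : 0 < K2).
  { assert (0 < K1 ^ 2 / (2 * c3)) by (apply Rdiv_lt_0_compat; [apply pow_lt|]; lra).
    unfold K2; lra. }
  exists (Rmin (r / 4) (c4 / (2 * K2))), K1.
  split; [apply Rmin_pos; [lra|apply Rdiv_lt_0_compat; lra]|]. split; [lra|].
  intros sigma nn j t0 D J Hsig Hnn [Ht0 Htd] Hj HD HJ.
  set (n := INR nn) in *.
  assert (Hn : 1 <= n) by (apply (le_INR 1); exact Hnn).
  set (m := n * c3 * t0) in *.
  assert (Hm : 0 < m) by (unfold m; repeat apply Rmult_lt_0_compat; lra).
  assert (Hsm : 0 < sqrt m) by (apply sqrt_lt_R0; exact Hm).
  assert (Hsm2 : sqrt m * sqrt m = m) by (apply sqrt_sqrt; lra).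
  assert (Htr : t0 <= r / 4) by (eapply Rle_trans; [exact Htd|apply Rmin_l]).
  assert (HtK : K2 * t0 <= c4 / 2).
  { assert (H : t0 <= c4 / (2 * K2)) by (eapply Rle_trans; [exact Htd|apply Rmin_r]).
    apply (Rmult_le_compat_l K2) in H; [|lra].
    replace (K2 * (c4 / (2 * K2))) with (c4 / 2) in H by (field; lra). exact H. }
  assert (Es2 : sqrt 2 * sqrt 2 = 2) by (apply sqrt_sqrt; lra).
  assert (Hs2 : 0 <= sqrt 2 <= 2).
  { pose proof (sqrt_pos 2). nra. }
  set (w := descent_dir sigma) in *.
  assert (Hw : Cmod w = 1) by (apply Cmod_descent_dir, Hsig).
  assert (Hsa : Rabs sigma = 1).
  { destruct (Rcase_abs sigma) as [H|H]; unfold Rabs; destruct (Rcase_abs sigma); nra. }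
  set (e1 := Cexp (RtoC (2 * sigma * (c3 * n * t0 ^ 3)) * Ci)%C).
  assert (He1 : Cmod e1 = 1).
  { unfold e1. rewrite Cmod_Cexp.
    replace (Re _) with 0 by (simpl; ring). apply exp_0. }
  pose (A := fun u : R => (- (RtoC (n * c3 * u ^ 3) * w))%C).
  (* The comparison function keeps the cubic term to first order; since that term is odd in u, the
     integral is still exactly the main term. *)
  pose (cmp := fun u : R => (RtoC (exp (- (c4 * n * t0 ^ 4))) * (w * e1) *
    (RtoC (exp (- (3 * m * u ^ 2))) * (RtoC 1 + A u)))%C).
  assert (Hcmp : is_CInt cmp (- (sqrt 2 * t0)) (sqrt 2 * t0)
    (RtoC (exp (- (c4 * n * t0 ^ 4)) * J) * (w * e1))%C).
  { pose proof (is_CInt_RtoC _ _ _ _ HJ) as H1.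
    pose proof (is_CInt_RtoC _ _ _ _
      (is_RInt_cube_gauss (3 * m) (sqrt 2 * t0) ltac:(lra))) as H2.
    pose proof (is_CInt_mult_l (RtoC (exp (- (c4 * n * t0 ^ 4))) * (w * e1))%C _ _ _ _
      (is_CInt_plus _ _ _ _ _ _ H1
        (is_CInt_mult_l (- (RtoC (n * c3) * w))%C _ _ _ _ H2))) as H3.
    replace (RtoC (exp (- (c4 * n * t0 ^ 4)) * J) * (w * e1))%C with
      (RtoC (exp (- (c4 * n * t0 ^ 4))) * (w * e1) *
        (RtoC J + - (RtoC (n * c3) * w) * RtoC 0))%C by (rewrite !RtoC_mult; ring).
    eapply is_CInt_ext; [|exact H3].
    intros u; cbv beta. unfold cmp, A. rewrite !RtoC_mult. ring. }
  pose proof (is_CInt_minus _ _ _ _ _ _ HD Hcmp) as Hdiff.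
  set (M := 27 / (c3 * n * t0 ^ 3)
   + K1 * exp (- (c4 / 2 * (n * t0 ^ 4))) * (n * (t0 ^ 3 / sqrt m + t0 ^ 5))).
  assert (Hp3 : 0 < t0 ^ 3) by (apply pow_lt; lra).
  assert (Hp4 : 0 < t0 ^ 4) by (apply pow_lt; lra).
  assert (Hp5 : 0 < t0 ^ 5) by (apply pow_lt; lra).
  assert (HT1 : 0 < t0 ^ 3 / sqrt m) by (apply Rdiv_lt_0_compat; lra).
  assert (HM1 : 0 < 27 / (c3 * n * t0 ^ 3)).
  { apply Rdiv_lt_0_compat; [lra|]. repeat apply Rmult_lt_0_compat; lra. }
  assert (HM : 0 <= M).
  { unfold M. apply Rplus_le_le_0_compat; [lra|].
    apply Rmult_le_pos; [apply Rmult_le_pos; [lra|apply Rlt_le, exp_pos]|].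
    apply Rmult_le_pos; lra. }
  refine (Cmod_CInt_gauss _ _ _ _ M m Hm HM _ _ Hdiff); [nra|].
  intros u Hu.
  assert (Hua : Rabs u <= sqrt 2 * t0) by (apply Rabs_le; lra).
  assert (Hua2 : Rabs u <= 2 * t0) by nra.
  pose proof (Rabs_pos u) as Hu0.
  unfold slanted_integrand, integrand. fold w.
  set (th := (RtoC (sigma * t0) + RtoC u * (RtoC sigma * w))%C).
  assert (Hth : Cmod th <= 3 * t0).
  { unfold th. eapply Rle_trans; [apply Cmod_triangle|].
    rewrite !Cmod_mult, !Cmod_R, Hw, Rabs_mult, Hsa, (Rabs_pos_eq t0) by lra. lra. }
  destruct (Hloc th) as [Hphi HF]; [lra|].
  rewrite HF, Cexp_pow, <- Cexp_plus. unfold log_symbol.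
  fold n. unfold th.
  rewrite (saddle_expansion alpha c3 c4 n (IZR j) t0 sigma u w _ (descent_dir_sqr sigma Hsig) Hsig Hj).
  fold th. set (E := (RtoC n * _)%C). fold m. fold (A u).
  rewrite <- (Cplus_assoc _ (A u) E). rewrite !Cexp_plus. fold e1.
  rewrite !Cexp_RtoC, <- (Cexp_plus (A u) E).
  unfold cmp.
  replace (_ - _)%C with (RtoC (exp (- (c4 * n * t0 ^ 4))) * RtoC (exp (- (3 * m * u ^ 2))) *
    (w * e1) * (Cexp (A u + E) - RtoC 1 - A u))%C by ring.
  rewrite !Cmod_mult, !Cmod_R, Hw, He1, !(Rabs_pos_eq (exp _)) by (apply Rlt_le, exp_pos).
  assert (HAm : Cmod (A u) = n * c3 * Rabs u ^ 3).
  { unfold A. rewrite Cmod_opp, Cmod_mult, Cmod_R, Hw, Rmult_1_r, Rabs_mult, RPow_abs.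
    rewrite (Rabs_pos_eq (n * c3)) by nra. reflexivity. }
  assert (Hu2 : u ^ 2 = Rabs u ^ 2) by apply (eq_sym (pow2_abs u)).
  assert (HAre : Re (A u) <= m * u ^ 2).
  { eapply Rle_trans; [apply Rle_abs|].
    replace (Re (A u)) with (- (n * c3 * (sqrt 2 / 2) * u ^ 3))
      by (unfold A, w, descent_dir; simpl; field).
    rewrite Rabs_Ropp, Rabs_mult, <- RPow_abs.
    rewrite (Rabs_pos_eq (n * c3 * (sqrt 2 / 2))) by (repeat apply Rmult_le_pos; lra).
    rewrite Hu2. unfold m.
    replace (n * c3 * (sqrt 2 / 2) * Rabs u ^ 3) with
      (n * c3 * Rabs u ^ 2 * (sqrt 2 / 2 * Rabs u)) by ring.
    replace (n * c3 * t0 * Rabs u ^ 2) with (n * c3 * Rabs u ^ 2 * t0) by ring.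
    apply Rmult_le_compat_l; [|nra].
    apply Rmult_le_pos; [nra|apply pow2_ge_0]. }
  assert (HE : Cmod E <= K1 * (n * (t0 ^ 3 * Rabs u + t0 ^ 5))).
  { unfold E. rewrite Cmod_mult, Cmod_R, (Rabs_pos_eq n) by lra.
    replace (K1 * (n * (t0 ^ 3 * Rabs u + t0 ^ 5))) with
      (n * (K1 * (t0 ^ 3 * Rabs u + t0 ^ 5))) by ring.
    apply Rmult_le_compat_l; [lra|].
    replace (th ^ 5 * phi th - c4 * (th ^ 4 - RtoC t0 ^ 4))%C with
      (th ^ 5 * phi th + RtoC c4 * - (th ^ 4 - RtoC t0 ^ 4))%C by ring.
    eapply Rle_trans; [apply Cmod_triangle|].
    rewrite !Cmod_mult, Cmod_opp, Cmod_pow, Cmod_R, (Rabs_pos_eq c4) by lra.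
    assert (H5 : Cmod th ^ 5 <= (3 * t0) ^ 5) by (apply pow_incr; split; [apply Cmod_ge_0|lra]).
    assert (H6 : Cmod th ^ 5 * Cmod (phi th) <= (3 * t0) ^ 5 * K0).
    { apply Rmult_le_compat; [apply pow_le, Cmod_ge_0|apply Cmod_ge_0|exact H5|exact Hphi]. }
    assert (Es : (RtoC sigma * RtoC sigma = RtoC 1)%C) by now rewrite <- RtoC_mult, Hsig.
    replace (th ^ 4)%C with ((RtoC t0 + RtoC u * w) ^ 4)%C.
    2:{ unfold th. rewrite RtoC_mult.
        transitivity ((RtoC sigma * RtoC sigma) * (RtoC sigma * RtoC sigma) *
          (RtoC t0 + RtoC u * w) ^ 4)%C; [rewrite Es; ring|ring]. }
    assert (Hv : Cmod (RtoC u * w)%C = Rabs u) by (rewrite Cmod_mult, Cmod_R, Hw; ring).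
    pose proof (Cmod_pow4_diff t0 (RtoC u * w)%C ltac:(lra) ltac:(lra)) as H7.
    rewrite Hv in H7.
    apply (Rmult_le_compat_l c4) in H7; [|lra].
    assert (0 <= K0 * (t0 ^ 3 * Rabs u)) by (repeat apply Rmult_le_pos; lra).
    assert (0 <= c4 * t0 ^ 5) by (apply Rmult_le_pos; lra).
    unfold K1. lra. }
  assert (HE2 : K1 * (n * (t0 ^ 3 * Rabs u + t0 ^ 5)) <= m / 2 * u ^ 2 + c4 / 2 * (n * t0 ^ 4)).
  { assert (H1 : K1 * n * t0 ^ 3 * Rabs u <= m / 2 * u ^ 2 + K1 ^ 2 / (2 * c3) * (n * t0 ^ 5)).
    { rewrite Hu2. apply Rminus_le.
      replace (_ - _) with (- (m / 2 * (Rabs u - K1 * n * t0 ^ 3 / m) ^ 2))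
        by (unfold m; field; lra).
      pose proof (pow2_ge_0 (Rabs u - K1 * n * t0 ^ 3 / m)). nra. }
    assert (H2 : K2 * t0 * (n * t0 ^ 4) <= c4 / 2 * (n * t0 ^ 4)).
    { apply Rmult_le_compat_r; [nra|exact HtK]. }
    unfold K2 in H2.
    replace ((K1 ^ 2 / (2 * c3) + K1) * t0 * (n * t0 ^ 4)) with
      (K1 ^ 2 / (2 * c3) * (n * t0 ^ 5) + K1 * n * t0 ^ 5) in H2 by (field; lra).
    lra. }
  pose proof (Cmod_exp_perturbation (A u) E (m * u ^ 2) _ HAre
    ltac:(apply Rmult_le_pos; [lra|apply pow2_ge_0]) (Rle_trans _ _ _ HE HE2)) as HP.
  set (X := m * u ^ 2) in *. set (Y := c4 / 2 * (n * t0 ^ 4)) in *.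
  replace (c4 * n * t0 ^ 4) with (Y + Y) by (unfold Y; field).
  replace (3 * m * u ^ 2) with (X + X + X) by (unfold X; ring).
  replace (m / 2 * u ^ 2) with (X / 2) in HP by (unfold X; field).
  assert (HX : 0 <= X) by (unfold X; apply Rmult_le_pos; [lra|apply pow2_ge_0]).
  assert (HY : 0 <= Y) by (unfold Y; apply Rmult_le_pos; [lra|nra]).
  assert (Q1 : Cmod (A u) ^ 2 <= 27 / (c3 * n * t0 ^ 3) * exp X).
  { rewrite HAm.
    replace ((n * c3 * Rabs u ^ 3) ^ 2) with (X ^ 3 / (c3 * n * t0 ^ 3)).
    - replace (27 / (c3 * n * t0 ^ 3) * exp X) with (27 * exp X / (c3 * n * t0 ^ 3))
        by (field; repeat split; lra).
      apply Rmult_le_compat_r; [|now apply pow3_le_exp].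
      left. apply Rinv_0_lt_compat. repeat apply Rmult_lt_0_compat; lra.
    - unfold X, m. rewrite Hu2. field. repeat split; lra. }
  assert (Q2 : Cmod E <= K1 * (n * (t0 ^ 3 / sqrt m + t0 ^ 5)) * exp (X / 2)).
  { eapply Rle_trans; [exact HE|].
    rewrite Rmult_assoc. apply Rmult_le_compat_l; [lra|].
    rewrite Rmult_assoc. apply Rmult_le_compat_l; [lra|].
    assert (H1 : 1 <= exp (X / 2)) by (rewrite <- exp_0; apply exp_le_compat; lra).
    assert (H2 : Rabs u * sqrt m <= exp (X / 2)).
    { eapply Rle_trans; [|apply exp_ineq1_le].
      assert (EX : X = (Rabs u * sqrt m) ^ 2).
      { unfold X. rewrite Hu2. transitivity (Rabs u ^ 2 * (sqrt m * sqrt m));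
          [rewrite Hsm2; ring|ring]. }
      rewrite EX. pose proof (pow2_ge_0 (Rabs u * sqrt m - 1)). lra. }
    rewrite Rmult_plus_distr_r. apply Rplus_le_compat.
    - replace (t0 ^ 3 * Rabs u) with (t0 ^ 3 / sqrt m * (Rabs u * sqrt m)) by (field; lra).
      apply Rmult_le_compat_l; [lra|exact H2].
    - rewrite <- (Rmult_1_r (t0 ^ 5)) at 1. apply Rmult_le_compat_l; lra. }
  set (T := K1 * (n * (t0 ^ 3 / sqrt m + t0 ^ 5))) in *.
  assert (HT : 0 <= T) by (unfold T; apply Rmult_le_pos; [lra|apply Rmult_le_pos; lra]).
  replace M with (27 / (c3 * n * t0 ^ 3) + T * exp (- Y)) by (unfold M, T, Y; ring).
  set (G := 27 / (c3 * n * t0 ^ 3)) in *.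
  assert (HG : Cmod (A u) ^ 2 + Cmod E * exp (X / 2 + Y) <= (G + T * exp Y) * exp X).
  { rewrite Rmult_plus_distr_r. apply Rplus_le_compat; [exact Q1|].
    replace (T * exp Y * exp X) with (T * exp (X / 2) * exp (X / 2 + Y)).
    - apply Rmult_le_compat_r; [apply Rlt_le, exp_pos|exact Q2].
    - rewrite !Rmult_assoc, <- !exp_plus. do 2 f_equal. field. }
  assert (HZ : exp (- (Y + Y)) * exp (- (X + X + X)) * (exp X * ((G + T * exp Y) * exp X))
     = (G * exp (- (Y + Y)) + T * exp (- Y)) * exp (- X)).
  { replace (exp (- (X + X + X))) with (exp (- X) * / exp X * / exp X)
      by (rewrite <- !exp_Ropp, <- !exp_plus; f_equal; ring).
    replace (exp (- (Y + Y))) with (exp (- Y) * / exp Y)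
      by (rewrite <- exp_Ropp, <- exp_plus; f_equal; ring).
    pose proof (exp_pos X). pose proof (exp_pos Y). field. lra. }
  assert (Hey : exp (- (Y + Y)) <= 1) by (rewrite <- exp_0; apply exp_le_compat; lra).
  eapply Rle_trans.
  { apply Rmult_le_compat_l;
      [|eapply Rle_trans; [exact HP|apply Rmult_le_compat_l; [apply Rlt_le, exp_pos|exact HG]]].
    apply Rmult_le_pos; [|lra].
    apply Rmult_le_pos; apply Rlt_le, exp_pos. }
  replace (exp (- (Y + Y)) * exp (- (X + X + X)) * (1 * 1)) with
    (exp (- (Y + Y)) * exp (- (X + X + X))) by ring.
  rewrite HZ. apply Rmult_le_compat_r; [apply Rlt_le, exp_pos|].
  apply Rplus_le_compat_r. rewrite <- (Rmult_1_r G) at 2.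
  apply Rmult_le_compat_l; lra.
Qed.

(** * Summation of the bounds *)

Lemma Series_telescope (u v : nat -> R) (B : R) :
  (forall k, 0 <= u k <= v (S k) - v k) -> (forall k, Rabs (v k) <= B) ->
  ex_series u /\ Series u <= 2 * B.
Proof.
  intros Hu Hv.
  assert (Hs : forall k, sum_n u k <= 2 * B).
  { assert (H : forall k, sum_n u k <= v (S k) - v O).
    { induction k as [|k IH]; [rewrite sum_O; apply Hu|].
      rewrite sum_Sn. unfold plus; simpl. specialize (Hu (S k)). lra. }
    intros k. specialize (H k). pose proof (Hv (S k)) as H1. pose proof (Hv O) as H2.
    apply Rabs_le_between in H1, H2. lra. }
  assert (Hex : ex_finite_lim_seq (sum_n u)).
  { apply ex_finite_lim_seq_incr with (2 * B); [|exact Hs].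
    intros k. rewrite sum_Sn. unfold plus; simpl. specialize (Hu (S k)). lra. }
  destruct Hex as [l Hl]. split; [exists l; exact Hl|].
  rewrite (is_series_unique u l Hl).
  exact (is_lim_seq_le _ _ (Finite l) (Finite (2 * B)) Hs Hl (is_lim_seq_const (2 * B))).
Qed.

(** On the negative half the index descends, so -T telescopes there. Only the supremum of |T| enters
    the bound, whatever the scale on which T varies. *)
Lemma Zseries_telescope (f T : Z -> R) (B : R) :
  (forall j, 0 <= f j <= T (j + 1)%Z - T j) -> (forall j, Rabs (T j) <= B) ->
  ex_Zseries f /\ Zseries f <= 4 * B.
Proof.
  intros Hf HT.
  destruct (Series_telescope (fun k => f (Z.of_nat k)) (fun k => T (Z.of_nat k)) B)
    as [E1 S1].
  { intros k. replace (Z.of_nat (S k)) with (Z.of_nat k + 1)%Z by lia. apply Hf. }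
  { intros k; apply HT. }
  destruct (Series_telescope (fun k => f (- Z.of_nat (S k))%Z)
    (fun k => - T (- Z.of_nat k)%Z) B) as [E2 S2].
  { intros k. specialize (Hf (- Z.of_nat (S k))%Z).
    replace (- Z.of_nat (S k) + 1)%Z with (- Z.of_nat k)%Z in Hf by lia. lra. }
  { intros k. rewrite Rabs_Ropp. apply HT. }
  split; [now split|]. unfold Zseries. lra.
Qed.

(** The power 3/2 is summable, weaker than the powers 7/4 and 2 that the estimates provide, and -2
    times the derivative in y of (1 + e y)^(-1/2), whence the telescoping. *)
Definition profile (e y : R) : R := e / sqrt (1 + e * y) ^ 3.

(** Truncating at 0 keeps it monotone and bounded on the whole line, so sums over a half-line
    telescope over Z. *)
Definition tail (e y : R) : R := / sqrt (1 + e * Rmax 0 y).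

(** With p and q the square roots at y and y + 1, q^2 - p^2 = e and 1/p - 1/q = e / (p q (p + q)).
    Since e <= 1 <= p, q is at most 2p, and p q (p + q) <= 6 p^3. *)
Lemma profile_le_tail (e y : R) : 0 < e <= 1 -> 0 <= y ->
  profile e y <= 6 * (tail e y - tail e (y + 1)).
Proof.
  intros He Hy. unfold profile, tail. rewrite !Rmax_right by lra.
  set (p := sqrt (1 + e * y)). set (q := sqrt (1 + e * (y + 1))).
  assert (Hp2 : p * p = 1 + e * y) by (apply sqrt_sqrt; nra).
  assert (Hq2 : q * q = p * p + e) by (rewrite Hp2; unfold q; rewrite sqrt_sqrt; nra).
  assert (Hp : 1 <= p) by (unfold p; rewrite <- sqrt_1 at 1; apply sqrt_le_1_alt; nra).
  assert (Hq : 0 < q) by (unfold q; apply sqrt_lt_R0; nra).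
  assert (Hq' : q <= 2 * p) by nra.
  replace (/ p - / q) with (e / (p * q * (p + q))).
  2:{ replace e with (q * q - p * p) by lra. field. repeat split; nra. }
  replace (6 * (e / (p * q * (p + q)))) with (e / (p * q * (p + q) / 6)) by (field; repeat split; nra).
  assert (H1 : p * q <= p * (2 * p)) by (apply Rmult_le_compat_l; lra).
  assert (H2 : p * q * (p + q) <= p * (2 * p) * (3 * p)) by (apply Rmult_le_compat; nra).
  apply Rmult_le_compat_l; [lra|].
  assert (H3 : 0 < p * q * (p + q)) by (repeat apply Rmult_lt_0_compat; lra).
  apply Rinv_le_contravar; [lra|]. simpl. lra.
Qed.

Lemma tail_decr (e y z : R) : 0 < e -> y <= z -> tail e z <= tail e y.
Proof.
  intros He Hyz. unfold tail.
  assert (H : Rmax 0 y <= Rmax 0 z) by (apply Rmax_lub; [apply Rmax_l|eapply Rle_trans; [exact Hyz|apply Rmax_r]]).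
  pose proof (Rmax_l 0 y).
  apply Rinv_le_contravar; [apply sqrt_lt_R0; nra|].
  apply sqrt_le_1_alt. nra.
Qed.

Lemma tail_bound (e y : R) : 0 < e -> 0 <= tail e y <= 1.
Proof.
  intros He. unfold tail. pose proof (Rmax_l 0 y).
  assert (1 <= sqrt (1 + e * Rmax 0 y)) by (rewrite <- sqrt_1 at 1; apply sqrt_le_1_alt; nra).
  set (p := sqrt (1 + e * Rmax 0 y)) in *.
  split; [left; apply Rinv_0_lt_compat; lra|].
  rewrite <- Rinv_1. apply Rinv_le_contravar; lra.
Qed.

Lemma Zseries_profile_right (f : Z -> R) (beta M e1 e2 : R) :
  0 < e1 <= 1 -> 0 < e2 <= 1 -> 0 <= M -> (forall j, 0 <= f j) ->
  (forall j, IZR j - beta < 0 -> f j = 0) ->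
  (forall j, 0 <= IZR j - beta ->
     f j <= M * (profile e1 (IZR j - beta) + profile e2 (IZR j - beta))) ->
  ex_Zseries f /\ Zseries f <= 48 * M.
Proof.
  intros He1 He2 HM H0 Hneg Hpos.
  (* The factor 6 of [profile_le_tail] is doubled for the two scales, and [Zseries_telescope]
     contributes 4. *)
  replace (48 * M) with (4 * (12 * M)) by ring.
  apply (Zseries_telescope f
    (fun j => - (6 * M * (tail e1 (IZR j - beta) + tail e2 (IZR j - beta))))).
  - intros j. split; [apply H0|]. rewrite plus_IZR.
    replace (IZR j + 1 - beta) with (IZR j - beta + 1) by ring.
    set (x := IZR j - beta) in *.
    destruct (Rlt_le_dec x 0) as [Hx|Hx].
    + rewrite (Hneg j Hx).
      pose proof (tail_decr e1 x (x + 1) ltac:(lra) ltac:(lra)).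
      pose proof (tail_decr e2 x (x + 1) ltac:(lra) ltac:(lra)). nra.
    + eapply Rle_trans; [apply Hpos; exact Hx|]. fold x.
      pose proof (profile_le_tail e1 x He1 Hx). pose proof (profile_le_tail e2 x He2 Hx).
      nra.
  - intros j. pose proof (tail_bound e1 (IZR j - beta) ltac:(lra)).
    pose proof (tail_bound e2 (IZR j - beta) ltac:(lra)).
    rewrite Rabs_Ropp, Rabs_pos_eq; nra.
Qed.

Lemma Zseries_profile_left (f : Z -> R) (beta M e1 e2 : R) :
  0 < e1 <= 1 -> 0 < e2 <= 1 -> 0 <= M -> (forall j, 0 <= f j) ->
  (forall j, 0 <= IZR j - beta -> f j = 0) ->
  (forall j, IZR j - beta < 0 ->
     f j <= M * (profile e1 (- (IZR j - beta)) + profile e2 (- (IZR j - beta)))) ->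
  ex_Zseries f /\ Zseries f <= 48 * M.
Proof.
  intros He1 He2 HM H0 Hpos Hneg.
  replace (48 * M) with (4 * (12 * M)) by ring.
  (* As y = -(j - beta) decreases when j grows, the shift by 1 is what makes the increment at j
     equal to tail(y) - tail(y + 1). *)
  apply (Zseries_telescope f
    (fun j => 6 * M * (tail e1 (- (IZR j - beta) + 1) + tail e2 (- (IZR j - beta) + 1)))).
  - intros j. split; [apply H0|]. rewrite plus_IZR.
    replace (- (IZR j + 1 - beta) + 1) with (- (IZR j - beta)) by ring.
    set (x := IZR j - beta) in *.
    destruct (Rlt_le_dec x 0) as [Hx|Hx].
    + eapply Rle_trans; [apply Hneg; exact Hx|]. fold x.
      pose proof (profile_le_tail e1 (- x) He1 ltac:(lra)).
      pose proof (profile_le_tail e2 (- x) He2 ltac:(lra)).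
      nra.
    + rewrite (Hpos j Hx).
      pose proof (tail_decr e1 (- x) (- x + 1) ltac:(lra) ltac:(lra)).
      pose proof (tail_decr e2 (- x) (- x + 1) ltac:(lra) ltac:(lra)). nra.
  - intros j. pose proof (tail_bound e1 (- (IZR j - beta) + 1) ltac:(lra)).
    pose proof (tail_bound e2 (- (IZR j - beta) + 1) ltac:(lra)).
    rewrite Rabs_pos_eq; nra.
Qed.

Lemma profile_nonneg (e y : R) : 0 < e -> 0 <= y -> 0 <= profile e y.
Proof.
  intros He Hy. unfold profile. apply Rmult_le_pos; [lra|].
  left. apply Rinv_0_lt_compat, pow_lt, sqrt_lt_R0. nra.
Qed.

Lemma profile_ge (e y : R) : 0 < e -> 0 <= y -> e / (1 + e * y) ^ 2 <= profile e y.
Proof.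
  intros He Hy. unfold profile.
  assert (H : 0 <= e * y) by (apply Rmult_le_pos; lra).
  assert (Hp2 : sqrt (1 + e * y) * sqrt (1 + e * y) = 1 + e * y) by (apply sqrt_sqrt; lra).
  assert (Hp : 1 <= sqrt (1 + e * y)) by (rewrite <- sqrt_1 at 1; apply sqrt_le_1_alt; lra).
  apply Rmult_le_compat_l; [lra|].
  apply Rinv_le_contravar; [apply pow_lt; lra|].
  set (p := sqrt (1 + e * y)) in *. rewrite <- Hp2.
  replace ((p * p) ^ 2) with (p ^ 3 * p) by ring.
  assert (0 < p ^ 3) by (apply pow_lt; lra). nra.
Qed.

(** For k > 0, exp(ct) is the k-th power of exp(ct/k) >= 1 + ct/k >= d (1 + t), with d the minimum
    of 1 and c/k. *)
Lemma pow_exp_bounded (k : nat) (c : R) : 0 < c ->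
  exists B, 0 < B /\ forall t, 0 <= t -> exp (- (c * t)) <= B / (1 + t) ^ k.
Proof.
  intros Hc. destruct k as [|k].
  { exists 1. split; [lra|]. intros t Ht. simpl.
    unfold Rdiv. rewrite Rinv_1, Rmult_1_r, <- exp_0. apply exp_le_compat. nra. }
  set (K := INR (S k)). assert (HK : 0 < K) by (apply lt_0_INR; lia).
  set (d := Rmin 1 (c / K)).
  assert (Hd : 0 < d) by (apply Rmin_pos; [lra|apply Rdiv_lt_0_compat; lra]).
  exists (/ d ^ S k). split; [apply Rinv_0_lt_compat, pow_lt, Hd|].
  intros t Ht.
  assert (E : exp (c * t) = exp (c / K * t) ^ S k).
  { rewrite exp_pow. fold K. f_equal. field. lra. }
  unfold Rdiv. rewrite exp_Ropp, <- Rinv_mult, E, <- Rpow_mult_distr.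
  apply Rinv_le_contravar; [apply pow_lt; nra|].
  apply pow_incr. split; [nra|].
  eapply Rle_trans; [|apply exp_ineq1_le].
  pose proof (Rmin_l 1 (c / K)) as H1. pose proof (Rmin_r 1 (c / K)) as H2. fold d in H1, H2.
  nra.
Qed.

Definition cbrt (n : nat) : R := Rpower (INR n) (/ 3).

Lemma cbrt_pow3 (n : nat) : (1 <= n)%nat -> cbrt n ^ 3 = INR n.
Proof.
  intros Hn. apply (le_INR 1) in Hn. simpl (INR 1) in Hn. unfold cbrt.
  rewrite <- Rpower_pow by apply exp_pos. rewrite Rpower_mult.
  replace (/ 3 * INR 3) with 1 by (simpl; field). apply Rpower_1. lra.
Qed.

Lemma cbrt_ge_1 (n : nat) : (1 <= n)%nat -> 1 <= cbrt n.
Proof.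
  intros Hn. pose proof (cbrt_pow3 n Hn) as H. apply (le_INR 1) in Hn. simpl (INR 1) in Hn.
  assert (0 < cbrt n) by apply exp_pos.
  destruct (Rlt_le_dec (cbrt n) 1) as [Hlt|Hle]; [|exact Hle].
  exfalso. assert (cbrt n ^ 3 < 1); [|lra].
  simpl. rewrite Rmult_1_r. assert (cbrt n * cbrt n < 1) by nra. nra.
Qed.

(** * Pointwise bounds on the Green's function *)

Lemma Cmod_integrand_le a n j alpha s t b :
  Cmod (Fhat a (s, t)) * exp (alpha * t) <= exp b ->
  Cmod (integrand a n j (s, t)) <= exp (INR n * b + (IZR j - alpha * INR n) * t).
Proof.
  intros H. rewrite (Cmod_integrand a n j alpha), exp_plus, <- exp_pow.
  apply Rmult_le_compat_r; [apply Rlt_le, exp_pos|].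
  apply pow_incr. split; [|exact H].
  apply Rmult_le_pos; [apply Cmod_ge_0|apply Rlt_le, exp_pos].
Qed.

(** At depth h / v, v = n^(1/3), the cubic loss 2 c3 n (h/v)^3 stays bounded, while the Gaussian
    rate 2 c3 h v^2 yields the prefactor 1 / v. *)
Lemma green_cbrt_decay a alpha c3 c4 : assumptionA a alpha c3 c4 -> 0 < c3 ->
  exists M h, 0 <= M /\ 0 < h /\ forall n j, (1 <= n)%nat ->
    Cmod (green a n j) <= M / cbrt n * exp (- (h * ((IZR j - alpha * INR n) / cbrt n))).
Proof.
  intros HA Hc3. destruct (finitely_supported_in a (proj1 HA)) as [N HN].
  destruct (Cmod_symbol_below a alpha c3 c4 HA Hc3) as (h & [Hh Hh1] & Hb).
  assert (Hk : 0 < 2 * c3 * h) by nra.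
  pose proof (sqrt_lt_R0 _ Hk) as Hsk.
  exists (exp (2 * c3 * h ^ 3) / sqrt (2 * c3 * h)), h.
  split; [|split; [exact Hh|]].
  { apply Rmult_le_pos; [apply Rlt_le, exp_pos|left; now apply Rinv_0_lt_compat]. }
  intros n j Hn. pose proof (cbrt_ge_1 n Hn) as Hv. pose proof (cbrt_pow3 n Hn) as Hv3.
  set (v := cbrt n) in *. set (x := IZR j - alpha * INR n).
  assert (Hhv : 0 <= h / v <= h).
  { split; [apply Rmult_le_pos; [lra|left; apply Rinv_0_lt_compat; lra]|].
    apply (Rmult_le_reg_r v); [lra|]. unfold Rdiv. rewrite Rmult_assoc, Rinv_l by lra. nra. }
  assert (Hkv : 0 < 2 * c3 * h * v ^ 2) by (apply Rmult_lt_0_compat; [lra|apply pow_lt; lra]).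
  assert (G := green_line a N n j (- (h / v))
    (exp (2 * c3 * h ^ 3) * exp (- (h * (x / v)))) (2 * c3 * h * v ^ 2) HN Hkv).
  rewrite sqrt_mult_alt, sqrt_pow2 in G by lra.
  replace (exp (2 * c3 * h ^ 3) / sqrt (2 * c3 * h) / v * exp (- (h * (x / v)))) with
    (exp (2 * c3 * h ^ 3) * exp (- (h * (x / v))) / (sqrt (2 * c3 * h) * v)) by (field; lra).
  apply G.
  - rewrite <- exp_plus. apply Rlt_le, exp_pos.
  - intros s Hs. rewrite <- !exp_plus.
    eapply Rle_trans; [apply Cmod_integrand_le, (Hb s (h / v) Hs); lra|].
    apply exp_le_compat. fold x. rewrite <- Hv3. right. field. lra.
Qed.

Lemma green_left_decay a alpha c3 c4 d : assumptionA a alpha c3 c4 -> 0 < c3 -> 0 < d ->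
  exists M k, 0 <= M /\ 0 < k /\ forall n j, (1 <= n)%nat ->
    d * INR n <= - (IZR j - alpha * INR n) ->
    Cmod (green a n j) <= M * exp (- (k * - (IZR j - alpha * INR n))).
Proof.
  intros HA Hc3 Hd. destruct (finitely_supported_in a (proj1 HA)) as [N HN].
  destruct (Cmod_symbol_above a alpha c3 c4 HA Hc3) as (t0 & B & Ht0 & HB & Hb).
  set (t := Rmin t0 (d / (2 * (B + 1)))).
  assert (Ht : 0 < t) by (apply Rmin_pos; [lra|apply Rdiv_lt_0_compat; lra]).
  assert (HBt : B * t <= d / 2).
  { assert (H : t <= d / (2 * (B + 1))) by apply Rmin_r.
    apply (Rmult_le_compat_r (2 * (B + 1))) in H; [|lra].
    replace (d / (2 * (B + 1)) * (2 * (B + 1))) with d in H by (field; lra). nra. }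
  (* [Cmod_symbol_above] gives no decay in s; the factor exp(PI^2) exp(-s^2), at least 1 on
     [-PI, PI], is inserted so that [green_line] applies with k = 1. *)
  exists (exp (PI ^ 2)), (t / 2).
  split; [apply Rlt_le, exp_pos|]. split; [lra|].
  intros n j Hn Hy. set (y := - (IZR j - alpha * INR n)) in *.
  assert (G := green_line a N n j t (exp (PI ^ 2) * exp (- (t / 2 * y))) 1 HN Rlt_0_1).
  rewrite sqrt_1, Rdiv_1_r in G. apply G.
  - rewrite <- exp_plus. apply Rlt_le, exp_pos.
  - intros s Hs. rewrite <- !exp_plus.
    eapply Rle_trans; [apply Cmod_integrand_le, (Hb s t Hs); split; [lra|apply Rmin_l]|].
    apply exp_le_compat.
    replace ((IZR j - alpha * INR n) * t) with (- y * t) by (unfold y; ring).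
    assert (s ^ 2 <= PI ^ 2).
    { rewrite <- (pow2_abs s). apply pow_incr. split; [apply Rabs_pos|exact Hs]. }
    pose proof (pos_INR n).
    assert (INR n * (B * t) <= INR n * (d / 2)) by (apply Rmult_le_compat_l; lra).
    assert (INR n * (B * t) * t <= y / 2 * t) by (apply Rmult_le_compat_r; lra).
    lra.
Qed.

(** * The approximation and the saddle point estimate *)

Lemma ex_RInt_gauss (k p q : R) : ex_RInt (fun u => exp (- (k * u ^ 2))) p q.
Proof.
  apply (ex_RInt_continuous (V := R_CompleteNormedModule)). intros u _.
  apply (ex_derive_continuous (V := R_NormedModule)). auto_derive; easy.
Qed.

Lemma approx_green_saddle alpha c3 c4 n j t0 : 0 < c3 -> (1 <= n)%nat -> 0 <= t0 ->
  IZR j - alpha * INR n = - (3 * c3 * INR n * t0 ^ 2) ->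
  approx_green alpha c3 c4 n j =
    1 / PI * exp (- (c4 * INR n * t0 ^ 4)) * cos (2 * (c3 * INR n * t0 ^ 3) - PI / 4) *
    RInt (fun u => exp (- (3 * (INR n * c3 * t0) * u ^ 2))) (- (sqrt 2 * t0)) (sqrt 2 * t0).
Proof.
  intros Hc3 Hn Ht0 Hj. apply (le_INR 1) in Hn. simpl (INR 1) in Hn.
  unfold approx_green. cbv zeta. rewrite Hj. set (m := INR n) in *.
  assert (Hcm : 0 < 3 * c3 * m) by (repeat apply Rmult_lt_0_compat; lra).
  assert (Hp2 : 0 <= t0 ^ 2) by apply pow2_ge_0.
  assert (Hp3 : 0 <= t0 ^ 3) by (apply pow_le; lra).
  rewrite Rabs_Ropp, (Rabs_pos_eq (3 * c3 * m * t0 ^ 2)) by nra.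
  replace (2 * (3 * c3 * m * t0 ^ 2) / (3 * c3 * m)) with (2 * t0 ^ 2) by (field; lra).
  rewrite (sqrt_mult_alt 2), (sqrt_pow2 t0) by lra.
  replace (3 * c3 * m * (3 * c3 * m * t0 ^ 2)) with ((3 * c3 * m * t0) ^ 2) by ring.
  rewrite sqrt_pow2 by nra.
  replace ((3 * c3 * m * t0 ^ 2) ^ 3) with (3 * c3 * m * (3 * c3 * m * t0 ^ 3) ^ 2) by ring.
  rewrite (sqrt_mult_alt (3 * c3 * m)), sqrt_pow2 by nra.
  pose proof (sqrt_lt_R0 _ Hcm) as Hs.
  f_equal; [f_equal; [f_equal|]|].
  - f_equal. field. lra.
  - f_equal. field. lra.
  - apply RInt_ext. intros u _. f_equal. ring.
Qed.

Lemma RInt_gauss_bound (k b : R) : 0 <= k -> 0 <= b ->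
  0 <= RInt (fun u => exp (- (k * u ^ 2))) (- b) b <= 2 * b.
Proof.
  intros Hk Hb. pose proof (ex_RInt_gauss k (- b) b) as Hex. split.
  - apply RInt_ge_0; [lra|exact Hex|]. intros; apply Rlt_le, exp_pos.
  - replace (2 * b) with (RInt (fun _ => 1) (- b) b).
    + apply RInt_le; [lra|exact Hex|apply ex_RInt_const|].
      intros u _. rewrite <- exp_0. apply exp_le_compat.
      pose proof (pow2_ge_0 u). nra.
    + rewrite RInt_const. unfold scal; simpl; unfold mult; simpl. ring.
Qed.

(** The integral is bounded by the length of its range; the full Gaussian integral, of order
    t0^(-1/2) for fixed n, would blow up as x tends to 0. *)
Lemma approx_green_bound alpha c3 c4 n j t0 : 0 < c3 -> (1 <= n)%nat -> 0 <= t0 ->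
  IZR j - alpha * INR n = - (3 * c3 * INR n * t0 ^ 2) ->
  Rabs (approx_green alpha c3 c4 n j) <= 2 * t0 * exp (- (c4 * INR n * t0 ^ 4)).
Proof.
  intros Hc3 Hn Ht0 Hj. rewrite (approx_green_saddle alpha c3 c4 n j t0 Hc3 Hn Ht0 Hj).
  pose proof PI_RGT_0. pose proof PI2_1.
  assert (Es2 : sqrt 2 * sqrt 2 = 2) by (apply sqrt_sqrt; lra).
  assert (Hs2 : 0 <= sqrt 2 <= 2) by (pose proof (sqrt_pos 2); nra).
  pose proof (RInt_gauss_bound (3 * (INR n * c3 * t0)) (sqrt 2 * t0)) as [J1 J2].
  { pose proof (pos_INR n). assert (0 <= INR n * c3) by nra. nra. }
  { nra. }
  set (J := RInt _ _ _) in *. set (e := exp _).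
  assert (He : 0 < e) by apply exp_pos.
  rewrite !Rabs_mult, (Rabs_pos_eq e), (Rabs_pos_eq J) by lra.
  rewrite (Rabs_pos_eq (1 / PI)) by (apply Rlt_le, Rdiv_lt_0_compat; lra).
  assert (Hcos : Rabs (cos (2 * (c3 * INR n * t0 ^ 3) - PI / 4)) <= 1).
  { apply Rabs_le, COS_bound. }
  set (co := Rabs _) in *. assert (Hco : 0 <= co) by apply Rabs_pos.
  assert (Hpi : 1 / PI <= 1 / 2).
  { unfold Rdiv. rewrite !Rmult_1_l. apply Rinv_le_contravar; lra. }
  assert (Hpi0 : 0 < 1 / PI) by (apply Rdiv_lt_0_compat; lra).
  assert (HcJ : co * J <= 1 * (4 * t0)) by (apply Rmult_le_compat; nra).
  assert (H3 : 1 / PI * (co * J) <= 1 / 2 * (4 * t0)).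
  { apply Rmult_le_compat; [lra|apply Rmult_le_pos; lra|lra|lra]. }
  replace (1 / PI * e * co * J) with (1 / PI * (co * J) * e) by ring.
  apply Rmult_le_compat_r; lra.
Qed.

(** The two saddle contributions are complex conjugates; the angle PI/4 of the directions of descent
    is the origin of the phase shift in the cosine. *)
Lemma descent_dir_sum (x : R) :
  (descent_dir 1 * Cexp (RtoC (2 * 1 * x) * Ci) +
   descent_dir (-1) * Cexp (RtoC (2 * -1 * x) * Ci))%C = RtoC (2 * cos (2 * x - PI / 4)).
Proof.
  assert (E2 : sqrt 2 * sqrt 2 = 2) by (apply sqrt_sqrt; lra).
  assert (H2 : 0 < sqrt 2) by (apply sqrt_lt_R0; lra).
  assert (Hh : 1 / sqrt 2 = sqrt 2 / 2).
  { apply (Rmult_eq_reg_r (sqrt 2)); [|lra].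
    transitivity 1; [field; lra|]. transitivity (sqrt 2 * sqrt 2 / 2); [rewrite E2; field|field]. }
  rewrite cos_minus, cos_PI4, sin_PI4, Hh.
  unfold Cexp.
  replace (Re (RtoC (2 * 1 * x) * Ci)%C) with 0 by (simpl; ring).
  replace (Re (RtoC (2 * -1 * x) * Ci)%C) with 0 by (simpl; ring).
  replace (Im (RtoC (2 * 1 * x) * Ci)%C) with (2 * x) by (simpl; ring).
  replace (Im (RtoC (2 * -1 * x) * Ci)%C) with (- (2 * x)) by (simpl; ring).
  rewrite cos_neg, sin_neg, exp_0.
  unfold descent_dir, RtoC, Cplus, Cmult; simpl; f_equal; field.
Qed.

(** 29 = 27 + 2: after division by 2 PI, the horizontal sides add 2 / (L sqrt(n c3 t0)) with L = c3
    n t0^3. *)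
Definition saddle_error (c3 c4 K n t0 : R) : R :=
  (29 / (c3 * n * t0 ^ 3)
   + K * exp (- (c4 / 2 * (n * t0 ^ 4))) * (n * (t0 ^ 3 / sqrt (n * c3 * t0) + t0 ^ 5)))
  / sqrt (n * c3 * t0).

Lemma green_saddle a alpha c3 c4 : assumptionA a alpha c3 c4 -> 0 < c3 ->
  exists d K, 0 < d <= 1 /\ 0 <= K /\ forall n j t0, (1 <= n)%nat -> 0 < t0 <= d ->
    IZR j - alpha * INR n = - (3 * c3 * INR n * t0 ^ 2) ->
    Cmod (green a n j - RtoC (approx_green alpha c3 c4 n j))%C
      <= saddle_error c3 c4 K (INR n) t0.
Proof.
  intros HA Hc3. destruct (finitely_supported_in a (proj1 HA)) as [N HN].
  destruct (Cmod_symbol_below a alpha c3 c4 HA Hc3) as (h0 & [Hh0 Hh1] & Hb).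
  destruct (slanted_estimate a alpha c3 c4 HA Hc3) as (d & K & Hd & HK & Hsl).
  exists (Rmin d h0), K. split; [split; [apply Rmin_pos; lra|
    eapply Rle_trans; [apply Rmin_r|lra]]|]. split; [exact HK|].
  intros n j t0 Hn [Ht0 Htd] Hj.
  assert (Htd1 : t0 <= d) by (eapply Rle_trans; [exact Htd|apply Rmin_l]).
  assert (Hth : t0 <= h0) by (eapply Rle_trans; [exact Htd|apply Rmin_r]).
  pose proof PI_RGT_0 as HPI. pose proof PI2_1 as HPI1.
  destruct (green_contour a N n j t0 HN) as (Il & Dl & Dr & Ir & HIl & HDl & HDr & HIr & Hsum).
  pose proof (RInt_correct _ _ _ (ex_RInt_gauss (3 * (INR n * c3 * t0))
    (- (sqrt 2 * t0)) (sqrt 2 * t0))) as HJ.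
  set (J := RInt _ _ _) in HJ.
  pose proof (Hsl (-1) n j t0 Dl J ltac:(ring) Hn (conj Ht0 Htd1) Hj HDl HJ) as El.
  pose proof (Hsl 1 n j t0 Dr J ltac:(ring) Hn (conj Ht0 Htd1) Hj HDr HJ) as Er.
  pose proof (approx_green_saddle alpha c3 c4 n j t0 Hc3 Hn (Rlt_le _ _ Ht0) Hj) as Happ.
  fold J in Happ.
  assert (Hn1 : 1 <= INR n) by (apply (le_INR 1) in Hn; exact Hn).
  set (m := INR n) in *.
  assert (Hp3 : 0 < t0 ^ 3) by (apply pow_lt; lra).
  set (L := c3 * m * t0 ^ 3) in *.
  assert (HL : 0 < L) by (unfold L; repeat apply Rmult_lt_0_compat; lra).
  assert (Hk : 0 < m * c3 * t0) by (repeat apply Rmult_lt_0_compat; lra).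
  pose proof (sqrt_lt_R0 _ Hk) as Hsk.
  assert (Hsk2 : sqrt (m * c3 * t0 / 4) = sqrt (m * c3 * t0) / 2).
  { replace (m * c3 * t0 / 4) with (m * c3 * t0 * (/ 2) ^ 2) by field.
    rewrite sqrt_mult_alt, sqrt_pow2 by lra. reflexivity. }
  (* At depth t0 the exponent is at most 5 L - 2 (n c3 t0) s^2. For |s| >= 2 t0, seven eighths of
     the quadratic term amount to at least 7 L, so stopping the slanted sides at abscissa 2 t0 is
     far enough; the last eighth is kept for the integration, and exp(-L) <= 1 / L. *)
  assert (Hline : forall s, 2 * t0 <= Rabs s <= PI ->
    Cmod (integrand a n j (s, - t0)) <= / L * exp (- (m * c3 * t0 / 4 * s ^ 2))).
  { intros s [Hs1 Hs2].
    eapply Rle_trans; [apply Cmod_integrand_le, (Hb s t0 Hs2); lra|].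
    fold m. rewrite Hj.
    assert (Hss : 4 * t0 ^ 2 <= s ^ 2).
    { rewrite <- (pow2_abs s). replace (4 * t0 ^ 2) with ((2 * t0) ^ 2) by ring.
      apply pow_incr; lra. }
    assert (H1 : m * c3 * t0 * (7 / 4) * (4 * t0 ^ 2) <= m * c3 * t0 * (7 / 4) * s ^ 2)
      by (apply Rmult_le_compat_l; lra).
    eapply Rle_trans with (exp (- L + - (m * c3 * t0 / 4 * s ^ 2))).
    - apply exp_le_compat. unfold L in *. lra.
    - rewrite exp_plus. apply Rmult_le_compat_r; [apply Rlt_le, exp_pos|].
      rewrite exp_Ropp. apply Rinv_le_contravar; [exact HL|].
      pose proof (exp_ineq1_le L). lra. }
  assert (HiL : 0 <= / L) by (left; now apply Rinv_0_lt_compat).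
  assert (Hk4 : 0 < m * c3 * t0 / 4) by lra.
  destruct (Rlt_le_dec PI (2 * t0)) as [Hbad|Hok]; [exfalso; lra|].
  assert (BIl : Cmod Il <= / L * (PI / (sqrt (m * c3 * t0) / 2))).
  { rewrite <- Hsk2. refine (Cmod_CInt_gauss _ _ _ _ _ _ Hk4 HiL _ _ HIl); [lra|].
    intros u Hu. apply Hline. rewrite Rabs_left1; lra. }
  assert (BIr : Cmod Ir <= / L * (PI / (sqrt (m * c3 * t0) / 2))).
  { rewrite <- Hsk2. refine (Cmod_CInt_gauss _ _ _ _ _ _ Hk4 HiL _ _ HIr); [lra|].
    intros u Hu. apply Hline. rewrite Rabs_pos_eq; lra. }
  set (g := green a n j) in *. set (b := approx_green alpha c3 c4 n j) in *.
  set (e := exp (- (c4 * m * t0 ^ 4))) in *.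
  match type of El with Cmod (_ - ?x)%C <= _ => set (ml := x) in * end.
  match type of Er with Cmod (_ - ?x)%C <= _ => set (mr := x) in * end.
  assert (Hb2 : (mr + ml)%C = (RtoC (2 * PI) * RtoC b)%C).
  { unfold mr, ml. rewrite <- Cmult_plus_distr_l, descent_dir_sum, <- !RtoC_mult.
    f_equal. rewrite Happ. field. lra. }
  assert (Hfin : Cmod (RtoC (2 * PI) * (g - RtoC b))%C <=
    2 * (/ L * (PI / (sqrt (m * c3 * t0) / 2))) + 2 * slanted_error c3 c4 K m t0).
  { replace (RtoC (2 * PI) * (g - RtoC b))%C with ((Il + Ir) + ((Dl - ml) + (Dr - mr)))%C.
    - eapply Rle_trans; [apply Cmod_triangle|].
      eapply Rle_trans; [apply Rplus_le_compat; apply Cmod_triangle|]. lra.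
    - transitivity (RtoC (2 * PI) * g - RtoC (2 * PI) * RtoC b)%C; [|ring].
      rewrite <- Hb2, Hsum. ring. }
  rewrite Cmod_mult, Cmod_R, Rabs_pos_eq in Hfin by lra.
  apply (Rmult_le_reg_l (2 * PI)); [lra|].
  eapply Rle_trans; [exact Hfin|]. right.
  unfold slanted_error, saddle_error. fold L. field. lra.
Qed.

(** * Bounds by summable profiles *)

Lemma gauss_bounded (c : R) : 0 < c ->
  exists B, 0 < B /\ forall q, 0 <= q ->
    (1 + q) ^ 2 * exp (- (c * q ^ 2)) <= B / (1 + q) ^ 2.
Proof.
  intros Hc. destruct (pow_exp_bounded 4 c Hc) as (B & HB & H).
  exists (exp c * B). split; [apply Rmult_lt_0_compat; [apply exp_pos|lra]|].
  intros q Hq.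
  assert (H1 : exp (- (c * q ^ 2)) <= exp c * exp (- (c * q))).
  { rewrite <- exp_plus. apply exp_le_compat. pose proof (pow2_ge_0 (q - 1)). nra. }
  assert (H2 : exp (- (c * q ^ 2)) <= exp c * (B / (1 + q) ^ 4)).
  { eapply Rle_trans; [exact H1|]. apply Rmult_le_compat_l; [apply Rlt_le, exp_pos|now apply H]. }
  replace (exp c * B / (1 + q) ^ 2) with ((1 + q) ^ 2 * (exp c * (B / (1 + q) ^ 4)))
    by (field; lra).
  apply Rmult_le_compat_l; [apply pow2_ge_0|exact H2].
Qed.

Lemma saddle_error_profile (c3 c4 K : R) : 0 < c3 -> 0 < c4 -> 0 <= K ->
  exists M, 0 <= M /\ forall n t0, (1 <= n)%nat -> 0 < t0 <= 1 ->
    cbrt n <= 3 * c3 * INR n * t0 ^ 2 ->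
    saddle_error c3 c4 K (INR n) t0 <=
      M * (profile (/ cbrt n) (3 * c3 * INR n * t0 ^ 2) +
           profile (/ sqrt (INR n)) (3 * c3 * INR n * t0 ^ 2)).
Proof.
  intros Hc3 Hc4 HK.
  set (p := sqrt (3 * c3)).
  assert (Hp : 0 < p) by (apply sqrt_lt_R0; lra).
  assert (Hp2 : p * p = 3 * c3) by (apply sqrt_sqrt; lra).
  assert (Hcp : 0 < c3 / p) by (apply Rdiv_lt_0_compat; lra).
  pose proof (sqrt_lt_R0 _ Hcp) as Hscp.
  pose proof (sqrt_lt_R0 _ Hc3) as Hsc3.
  destruct (gauss_bounded (c4 / (18 * c3 ^ 2))) as (B & HB & Hgauss).
  { apply Rdiv_lt_0_compat; [lra|]. pose proof (pow_lt c3 2 Hc3); lra. }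
  set (M1 := 232 * p ^ 3 / (c3 * sqrt (c3 / p))).
  set (K' := / (3 * c3 ^ 2) + / (9 * c3 ^ 2 * sqrt c3)).
  assert (Hcc : 0 < c3 ^ 2) by (apply pow_lt; lra).
  assert (Hpp : 0 < p ^ 3) by (apply pow_lt; lra).
  assert (HM1 : 0 < M1) by (apply Rdiv_lt_0_compat; nra).
  assert (HK'1 : 0 < / (3 * c3 ^ 2)) by (apply Rinv_0_lt_compat; lra).
  assert (HK'2 : 0 < / (9 * c3 ^ 2 * sqrt c3)) by (apply Rinv_0_lt_compat; nra).
  assert (HK' : 0 < K') by (unfold K'; lra).
  assert (HM2 : 0 <= K * K' * B) by (repeat apply Rmult_le_pos; lra).
  exists (M1 + K * K' * B). split; [lra|].
  intros n t0 Hn [Ht0 Ht1] Hy.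
  pose proof (cbrt_ge_1 n Hn) as Hv. pose proof (cbrt_pow3 n Hn) as Hv3.
  set (v := cbrt n) in *.
  assert (Hn1 : 1 <= INR n) by (apply (le_INR 1) in Hn; exact Hn).
  set (N := INR n) in *.
  assert (Hmu : 0 < sqrt N) by (apply sqrt_lt_R0; lra).
  assert (Hmu2 : sqrt N * sqrt N = N) by (apply sqrt_sqrt; lra).
  set (y := 3 * c3 * N * t0 ^ 2) in *.
  assert (Hy0 : 0 < y) by lra.
  set (m := N * c3 * t0).
  assert (Hm : 0 < m) by (unfold m; repeat apply Rmult_lt_0_compat; lra).
  pose proof (sqrt_lt_R0 _ Hm) as Hsm.
  assert (Hsm2 : sqrt m * sqrt m = m) by (apply sqrt_sqrt; lra).
  assert (Hp3 : 0 < t0 ^ 3) by (apply pow_lt; lra).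
  set (L := c3 * N * t0 ^ 3).
  assert (HL : 0 < L) by (unfold L; repeat apply Rmult_lt_0_compat; lra).
  assert (Hpf1 : 0 <= profile (/ v) y)
    by (apply profile_nonneg; [apply Rinv_0_lt_compat|]; lra).
  assert (Hpf2 : 0 <= profile (/ sqrt N) y)
    by (apply profile_nonneg; [apply Rinv_0_lt_compat|]; lra).
  (* In terms of z = v t0 one has y / v = 3 c3 z^2, L = c3 z^3 and m = c3 v^2 z. The quotient decays
     like z^(-7/2) / v; bounding z below inside sqrt m leaves z^(-3) / v, the size of the profile.
     In [M1], 232 = 29 times 2^3. *)
  assert (First : 29 / L / sqrt m <= M1 * profile (/ v) y).
  { set (z := v * t0).
    assert (Hz : 0 < z) by (unfold z; nra).
    assert (Er : / v * y = (p * z) ^ 2).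
    { unfold y, z. rewrite <- Hv3. transitivity ((p * p) * (v * t0) ^ 2); [rewrite Hp2; field; lra|ring]. }
    assert (Hr : 1 <= (p * z) ^ 2).
    { rewrite <- Er. apply (Rmult_le_reg_l v); [lra|]. rewrite <- Rmult_assoc, Rinv_r by lra. lra. }
    assert (Hpz : 1 <= p * z).
    { destruct (Rlt_le_dec (p * z) 1) as [H|H]; [|exact H]. exfalso.
      assert (0 < p * z) by nra. nra. }
    unfold profile. rewrite Er. set (s := sqrt (1 + (p * z) ^ 2)).
    assert (Hs0 : 0 < s) by (apply sqrt_lt_R0; nra).
    assert (Hs : s <= 2 * p * z).
    { unfold s. rewrite <- (sqrt_pow2 (2 * p * z)) by nra. apply sqrt_le_1_alt. nra. }
    assert (Hs3 : s ^ 3 <= (2 * p * z) ^ 3) by (apply pow_incr; lra).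
    assert (Hs30 : 0 < s ^ 3) by (apply pow_lt; lra).
    assert (Hz3 : 0 < z ^ 3) by (apply pow_lt; lra).
    assert (EL : L = c3 * z ^ 3) by (unfold L, z; rewrite <- Hv3; ring).
    assert (Hsmv : v * sqrt (c3 / p) <= sqrt m).
    { replace m with (v ^ 2 * (c3 * z)) by (unfold m, z; rewrite <- Hv3; ring).
      rewrite sqrt_mult_alt, sqrt_pow2 by (try apply pow2_ge_0; lra).
      apply Rmult_le_compat_l; [lra|]. apply sqrt_le_1_alt.
      apply (Rmult_le_reg_r p); [lra|]. replace (c3 / p * p) with c3 by (field; lra). nra. }
    rewrite EL. apply Rle_trans with (29 / (c3 * z ^ 3) / (v * sqrt (c3 / p))).
    - apply Rmult_le_compat_l; [apply Rlt_le, Rdiv_lt_0_compat; nra|].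
      apply Rinv_le_contravar; [nra|exact Hsmv].
    - replace (29 / (c3 * z ^ 3) / (v * sqrt (c3 / p))) with
        (M1 * (/ v / (2 * p * z) ^ 3)).
      + apply Rmult_le_compat_l; [lra|].
        apply Rmult_le_compat_l; [left; apply Rinv_0_lt_compat; lra|].
        apply Rinv_le_contravar; lra.
      + unfold M1. field. repeat split; lra. }
  set (q := / sqrt N * y).
  assert (Hq : 0 < q) by (unfold q; apply Rmult_lt_0_compat; [apply Rinv_0_lt_compat|]; lra).
  assert (Et2 : t0 ^ 2 = q / (3 * c3 * sqrt N)).
  { unfold q, y. transitivity (t0 ^ 2 * (N / (sqrt N * sqrt N))); [rewrite Hmu2; field; lra|field; lra]. }
  (* The exponential is a Gaussian in q = y / sqrt N, and the other factors are at most a constant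
     times (1 + q)^2 / sqrt N: the scale here is sqrt N. The Gaussian supplies four powers of 1 / (1
     + q), two for this polynomial and two for the profile. *)
  assert (Second : K * exp (- (c4 / 2 * (N * t0 ^ 4))) *
      (N * (t0 ^ 3 / sqrt m + t0 ^ 5)) / sqrt m <= K * K' * B * profile (/ sqrt N) y).
  { assert (Ent4 : N * t0 ^ 4 = q ^ 2 / (9 * c3 ^ 2)).
    { replace (t0 ^ 4) with ((t0 ^ 2) ^ 2) by ring. rewrite Et2.
      transitivity (sqrt N * sqrt N * (q / (3 * c3 * sqrt N)) ^ 2); [rewrite Hmu2; ring|field; lra]. }
    replace (c4 / 2 * (N * t0 ^ 4)) with (c4 / (18 * c3 ^ 2) * q ^ 2)
      by (rewrite Ent4; field; lra).
    assert (HA : N * (t0 ^ 3 / sqrt m + t0 ^ 5) / sqrt m <= / sqrt N * (K' * (1 + q) ^ 2)).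
    { replace (N * (t0 ^ 3 / sqrt m + t0 ^ 5) / sqrt m) with
        (N * t0 ^ 3 / (sqrt m * sqrt m) + N * t0 ^ 4 * (t0 / sqrt m)) by (field; lra).
      rewrite Hsm2. replace (N * t0 ^ 3 / m) with (/ sqrt N * (/ (3 * c3 ^ 2) * q)).
      2:{ transitivity (t0 ^ 2 / c3); [rewrite Et2; field; lra|unfold m; field; lra]. }
      assert (Hts : t0 / sqrt m <= / sqrt N * / sqrt c3).
      { rewrite <- Rinv_mult, <- sqrt_mult_alt by lra.
        assert (Hnc : 0 < sqrt (N * c3)) by (apply sqrt_lt_R0; nra).
        apply (Rmult_le_reg_r (sqrt (N * c3) * sqrt m)); [nra|].
        replace (t0 / sqrt m * (sqrt (N * c3) * sqrt m)) with (t0 * sqrt (N * c3)) by (field; lra).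
        replace (/ sqrt (N * c3) * (sqrt (N * c3) * sqrt m)) with (sqrt m) by (field; lra).
        rewrite <- (sqrt_pow2 t0) at 1 by lra.
        rewrite <- sqrt_mult_alt by apply pow2_ge_0. apply sqrt_le_1_alt.
        unfold m. rewrite Rmult_comm. apply Rmult_le_compat_l; [nra|]. nra. }
      assert (Hn4 : N * t0 ^ 4 * (t0 / sqrt m) <= / sqrt N * (/ (9 * c3 ^ 2 * sqrt c3) * q ^ 2)).
      { rewrite Ent4.
        replace (/ sqrt N * (/ (9 * c3 ^ 2 * sqrt c3) * q ^ 2)) with
          (q ^ 2 / (9 * c3 ^ 2) * (/ sqrt N * / sqrt c3)) by (field; lra).
        apply Rmult_le_compat_l; [|exact Hts].
        apply Rmult_le_pos; [apply pow2_ge_0|left; apply Rinv_0_lt_compat; lra]. }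
      eapply Rle_trans; [apply Rplus_le_compat_l, Hn4|].
      rewrite <- Rmult_plus_distr_l.
      apply Rmult_le_compat_l; [left; now apply Rinv_0_lt_compat|].
      unfold K'. nra. }
    pose proof (profile_ge (/ sqrt N) y (Rinv_0_lt_compat _ Hmu) (Rlt_le _ _ Hy0)) as Hpg.
    fold q in Hpg. specialize (Hgauss q (Rlt_le _ _ Hq)).
    set (g := exp _) in *. assert (Hg : 0 < g) by apply exp_pos.
    apply Rle_trans with (K * g * (/ sqrt N * (K' * (1 + q) ^ 2))).
    - replace (K * g * (N * (t0 ^ 3 / sqrt m + t0 ^ 5)) / sqrt m) with
        (K * g * (N * (t0 ^ 3 / sqrt m + t0 ^ 5) / sqrt m)) by (field; lra).
      apply Rmult_le_compat_l; [nra|exact HA].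
    - replace (K * g * (/ sqrt N * (K' * (1 + q) ^ 2))) with
        (K * K' * / sqrt N * ((1 + q) ^ 2 * g)) by ring.
      apply Rle_trans with (K * K' * / sqrt N * (B / (1 + q) ^ 2)).
      + apply Rmult_le_compat_l; [|exact Hgauss].
        repeat apply Rmult_le_pos; try lra. left; now apply Rinv_0_lt_compat.
      + replace (K * K' * / sqrt N * (B / (1 + q) ^ 2)) with
          (K * K' * B * (/ sqrt N / (1 + q) ^ 2)) by (field; lra).
        apply Rmult_le_compat_l; [exact HM2|exact Hpg]. }
  unfold saddle_error. fold m L.
  unfold Rdiv at 1. rewrite Rmult_plus_distr_r.
  change (29 / L * / sqrt m) with (29 / L / sqrt m).
  match goal with |- _ + ?x * / sqrt m <= _ => change (x * / sqrt m) with (x / sqrt m) end.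
  nra.
Qed.

Lemma green_right_profile a alpha c3 c4 : assumptionA a alpha c3 c4 -> 0 < c3 ->
  exists M, 0 <= M /\ forall n j, (1 <= n)%nat -> 0 <= IZR j - alpha * INR n ->
    Cmod (green a n j) <= M * profile (/ cbrt n) (IZR j - alpha * INR n).
Proof.
  intros HA Hc3. destruct (green_cbrt_decay a alpha c3 c4 HA Hc3) as (M & h & HM & Hh & H).
  destruct (pow_exp_bounded 2 h Hh) as (B & HB & HE).
  exists (M * B). split; [nra|]. intros n j Hn Hx.
  pose proof (cbrt_ge_1 n Hn) as Hv. set (v := cbrt n) in *.
  set (x := IZR j - alpha * INR n) in *.
  assert (Hiv : 0 < / v) by (apply Rinv_0_lt_compat; lra).
  assert (Hxv : 0 <= / v * x) by nra.
  eapply Rle_trans; [apply H, Hn|]. fold v x.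
  replace (x / v) with (/ v * x) by (unfold Rdiv; ring).
  apply Rle_trans with (M / v * (B / (1 + / v * x) ^ 2)).
  - apply Rmult_le_compat_l; [apply Rmult_le_pos; lra|]. now apply HE.
  - replace (M / v * (B / (1 + / v * x) ^ 2)) with (M * B * (/ v / (1 + / v * x) ^ 2)) by (field; nra).
    apply Rmult_le_compat_l; [nra|]. now apply profile_ge.
Qed.

Lemma green_left_profile a alpha c3 c4 : assumptionA a alpha c3 c4 -> 0 < c3 ->
  exists M, 0 <= M /\ forall n j, (1 <= n)%nat -> IZR j - alpha * INR n < 0 ->
    Cmod (green a n j - RtoC (approx_green alpha c3 c4 n j))%C <=
      M * (profile (/ cbrt n) (- (IZR j - alpha * INR n)) +
           profile (/ sqrt (INR n)) (- (IZR j - alpha * INR n))).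
Proof.
  intros HA Hc3. assert (Hc4 : 0 < c4) by apply HA.
  destruct (green_cbrt_decay a alpha c3 c4 HA Hc3) as (Ma & h & HMa & Hh & Hnear).
  destruct (green_saddle a alpha c3 c4 HA Hc3) as (d & K & [Hd Hd1] & HK & Hmid).
  destruct (saddle_error_profile c3 c4 K Hc3 Hc4 HK) as (Mb & HMb & Hmid2).
  assert (Hdd : 0 < 3 * c3 * d ^ 2) by (pose proof (pow_lt d 2 Hd); nra).
  destruct (green_left_decay a alpha c3 c4 (3 * c3 * d ^ 2) HA Hc3 Hdd)
    as (Mc & k & HMc & Hk & Hfar).
  (* Far to the left one power of 1 + y pays for sqrt N, as y >= 3 c3 d^2 N there; the other two
     give the profile at scale sqrt N. *)
  destruct (pow_exp_bounded 3 k Hk) as (Bk & HBk & HE).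
  destruct (gauss_bounded (c4 / (9 * c3 ^ 2))) as (B & HB & Hgauss).
  { apply Rdiv_lt_0_compat; [lra|]. pose proof (pow_lt c3 2 Hc3); lra. }
  pose proof (exp_pos h) as Heh.
  set (p := sqrt (/ (3 * c3))).
  assert (Hp : 0 <= p) by apply sqrt_pos.
  set (M1 := 4 * (Ma * exp h + 2 * p)).
  set (M2 := Mc * Bk / (3 * c3 * d ^ 2) + 2 * B / (3 * c3 * d)).
  assert (HM1 : 0 <= M1) by (unfold M1; nra).
  assert (HM2a : 0 <= Mc * Bk / (3 * c3 * d ^ 2)).
  { apply Rmult_le_pos; [nra|left; now apply Rinv_0_lt_compat]. }
  assert (HM2b : 0 <= 2 * B / (3 * c3 * d)).
  { apply Rlt_le, Rdiv_lt_0_compat; nra. }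
  exists (M1 + Mb + M2). split; [unfold M2; lra|].
  intros n j Hn Hx.
  pose proof (cbrt_ge_1 n Hn) as Hv. pose proof (cbrt_pow3 n Hn) as Hv3.
  set (v := cbrt n) in *.
  assert (Hn1 : 1 <= INR n) by (apply (le_INR 1) in Hn; exact Hn).
  specialize (Hnear n j Hn). fold v in Hnear.
  specialize (Hmid n j). specialize (Hfar n j Hn). specialize (Hmid2 n).
  pose proof (approx_green_bound alpha c3 c4 n j) as Happ.
  set (N := INR n) in *. set (x := IZR j - alpha * N) in *.
  set (y := - x) in *. assert (Hy : 0 < y) by (unfold y; lra).
  assert (HcN : 0 < 3 * c3 * N) by nra.
  set (t0 := sqrt (y / (3 * c3 * N))) in *.
  assert (Hyd : 0 < y / (3 * c3 * N)) by (apply Rdiv_lt_0_compat; lra).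
  assert (Ht0 : 0 < t0) by (apply sqrt_lt_R0; lra).
  assert (Et2 : t0 ^ 2 = y / (3 * c3 * N)) by (unfold t0; apply pow2_sqrt; lra).
  assert (Ey : 3 * c3 * N * t0 ^ 2 = y) by (rewrite Et2; field; lra).
  assert (Exj : x = - (3 * c3 * N * t0 ^ 2)) by (rewrite Ey; unfold y; ring).
  specialize (Happ t0 Hc3 Hn (Rlt_le _ _ Ht0) Exj).
  assert (Hmu : 0 < sqrt N) by (apply sqrt_lt_R0; lra).
  assert (Hmu2 : sqrt N * sqrt N = N) by (apply sqrt_sqrt; lra).
  assert (Hiv : 0 < / v) by (apply Rinv_0_lt_compat; lra).
  assert (Himu : 0 < / sqrt N) by now apply Rinv_0_lt_compat.
  pose proof (profile_nonneg (/ v) y Hiv (Rlt_le _ _ Hy)) as Hpf1.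
  pose proof (profile_nonneg (/ sqrt N) y Himu (Rlt_le _ _ Hy)) as Hpf2.
  pose proof (profile_ge (/ v) y Hiv (Rlt_le _ _ Hy)) as Hpg1.
  pose proof (profile_ge (/ sqrt N) y Himu (Rlt_le _ _ Hy)) as Hpg2.
  set (P1 := profile (/ v) y) in *. set (P2 := profile (/ sqrt N) y) in *.
  assert (Htri : Cmod (green a n j - RtoC (approx_green alpha c3 c4 n j))%C <=
    Cmod (green a n j) + Rabs (approx_green alpha c3 c4 n j)).
  { unfold Cminus. eapply Rle_trans; [apply Cmod_triangle|].
    rewrite Cmod_opp, Cmod_R. lra. }
  assert (HM2 : 0 <= M2) by (unfold M2; lra).
  destruct (Rlt_le_dec y v) as [Hyv|Hyv].
  (* Within distance v of the front, the Green's function and its approximation are each bounded by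
     a multiple of 1 / v; no cancellation is used. *)
  - assert (Hr : / v * y <= 1).
    { apply (Rmult_le_reg_l v); [lra|]. rewrite <- Rmult_assoc, Rinv_r by lra. lra. }
    assert (Hr0 : 0 < / v * y) by nra.
    assert (HP1 : / v <= 4 * P1).
    { assert (H1 : / v / 4 <= / v / (1 + / v * y) ^ 2).
      { apply Rmult_le_compat_l; [lra|]. apply Rinv_le_contravar; nra. }
      lra. }
    assert (HG : Cmod (green a n j) <= Ma * exp h * / v).
    { eapply Rle_trans; [exact Hnear|].
      replace (Ma * exp h * / v) with (Ma / v * exp h) by (field; lra).
      apply Rmult_le_compat_l; [apply Rmult_le_pos; lra|].
      apply exp_le_compat. replace (x / v) with (- (/ v * y)) by (unfold y; field; lra). nra. }
    assert (Ht : t0 <= p * / v).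
    { unfold t0, p. rewrite <- (sqrt_pow2 (/ v)) by lra.
      rewrite <- sqrt_mult_alt by (left; apply Rinv_0_lt_compat; lra).
      apply sqrt_le_1_alt. rewrite <- Hv3.
      replace (y / (3 * c3 * v ^ 3)) with (/ (3 * c3) * (/ v) ^ 2 * (/ v * y)) by (field; lra).
      rewrite <- (Rmult_1_r (/ (3 * c3) * (/ v) ^ 2)) at 2.
      apply Rmult_le_compat_l; [|exact Hr].
      apply Rmult_le_pos; [left; apply Rinv_0_lt_compat; lra|apply pow2_ge_0]. }
    assert (He : exp (- (c4 * N * t0 ^ 4)) <= 1).
    { rewrite <- exp_0. apply exp_le_compat.
      assert (0 <= c4 * N * t0 ^ 4); [|lra].
      apply Rmult_le_pos; [nra|apply pow_le; lra]. }
    assert (HP : Rabs (approx_green alpha c3 c4 n j) <= 2 * p * / v).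
    { eapply Rle_trans; [exact Happ|].
      pose proof (exp_pos (- (c4 * N * t0 ^ 4))). nra. }
    assert (Ma * exp h * / v + 2 * p * / v <= M1 * P1).
    { unfold M1. replace (Ma * exp h * / v + 2 * p * / v) with ((Ma * exp h + 2 * p) * / v) by ring.
      replace (4 * (Ma * exp h + 2 * p) * P1) with ((Ma * exp h + 2 * p) * (4 * P1)) by ring.
      apply Rmult_le_compat_l; nra. }
    nra.
  - destruct (Rle_lt_dec t0 d) as [Htd|Htd].
    + eapply Rle_trans; [apply (Hmid t0 Hn (conj Ht0 Htd) Exj)|].
      eapply Rle_trans; [apply Hmid2; [exact Hn|lra|fold v; rewrite Ey; exact Hyv]|].
      fold v. rewrite Ey. fold P1 P2. nra.
    + assert (Hdt : d ^ 2 <= t0 ^ 2) by (apply pow_incr; lra).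
      assert (Hfy : 3 * c3 * d ^ 2 * N <= y).
      { rewrite <- Ey. replace (3 * c3 * d ^ 2 * N) with (3 * c3 * N * d ^ 2) by ring.
        apply Rmult_le_compat_l; lra. }
      specialize (Hfar Hfy).
      set (q := / sqrt N * y) in *.
      assert (Hq : 0 < q) by (unfold q; nra).
      assert (Hmu1 : 1 <= sqrt N) by (rewrite <- sqrt_1; apply sqrt_le_1_alt; lra).
      assert (HG : Cmod (green a n j) <= Mc * Bk / (3 * c3 * d ^ 2) * P2).
      { assert (Hqy : q <= y).
        { unfold q. rewrite <- (Rmult_1_l y) at 2. apply Rmult_le_compat_r; [lra|].
          rewrite <- Rinv_1. apply Rinv_le_contravar; lra. }
        assert (HmuN : sqrt N <= N) by nra.
        eapply Rle_trans; [exact Hfar|].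
        eapply Rle_trans; [apply Rmult_le_compat_l; [exact HMc|apply HE; lra]|].
        apply Rle_trans with (Mc * Bk / (3 * c3 * d ^ 2) * (/ sqrt N / (1 + q) ^ 2));
          [|apply Rmult_le_compat_l; [exact HM2a|exact Hpg2]].
        replace (Mc * Bk / (3 * c3 * d ^ 2) * (/ sqrt N / (1 + q) ^ 2)) with
          (Mc * (Bk / (3 * c3 * d ^ 2 * sqrt N * (1 + q) ^ 2))) by (field; nra).
        apply Rmult_le_compat_l; [exact HMc|].
        apply Rmult_le_compat_l; [lra|].
        apply Rinv_le_contravar.
        - apply Rmult_lt_0_compat; [nra|apply pow_lt; lra].
        - replace ((1 + y) ^ 3) with ((1 + y) * (1 + y) ^ 2) by ring.
          apply Rmult_le_compat; [nra|apply pow2_ge_0| |apply pow_incr; lra].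
          assert (3 * c3 * d ^ 2 * sqrt N <= 3 * c3 * d ^ 2 * N) by (apply Rmult_le_compat_l; lra).
          lra. }
      assert (HP : Rabs (approx_green alpha c3 c4 n j) <= 2 * B / (3 * c3 * d) * P2).
      { assert (Etq : t0 ^ 2 = q / (3 * c3 * sqrt N)).
        { rewrite Et2. unfold q. transitivity (y / (3 * c3 * (sqrt N * sqrt N)));
            [rewrite Hmu2; reflexivity|field; lra]. }
        assert (Ent4 : c4 * N * t0 ^ 4 = c4 / (9 * c3 ^ 2) * q ^ 2).
        { replace (t0 ^ 4) with ((t0 ^ 2) ^ 2) by ring. rewrite Etq.
          transitivity (c4 * (sqrt N * sqrt N) * (q / (3 * c3 * sqrt N)) ^ 2);
            [rewrite Hmu2; ring|field; lra]. }
        (* From t0 > d follows t0 <= t0^2 / d, which trades t0 for q / sqrt N. *)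
        assert (Ht : t0 <= q / (3 * c3 * d) * / sqrt N).
        { apply (Rmult_le_reg_l d); [lra|].
          replace (d * (q / (3 * c3 * d) * / sqrt N)) with (q / (3 * c3 * sqrt N)) by (field; lra).
          rewrite <- Etq. nra. }
        eapply Rle_trans; [exact Happ|]. rewrite Ent4.
        specialize (Hgauss q (Rlt_le _ _ Hq)).
        set (g := exp (- (c4 / (9 * c3 ^ 2) * q ^ 2))) in *. assert (Hg : 0 < g) by apply exp_pos.
        apply Rle_trans with (2 * B / (3 * c3 * d) * (/ sqrt N / (1 + q) ^ 2));
          [|apply Rmult_le_compat_l; [exact HM2b|exact Hpg2]].
        replace (2 * B / (3 * c3 * d) * (/ sqrt N / (1 + q) ^ 2)) with
          (2 / (3 * c3 * d) * / sqrt N * (B / (1 + q) ^ 2)) by (field; lra).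
        assert (Hc0 : 0 <= 2 / (3 * c3 * d) * / sqrt N).
        { apply Rmult_le_pos; [|lra]. apply Rlt_le, Rdiv_lt_0_compat; nra. }
        eapply Rle_trans; [|apply Rmult_le_compat_l; [exact Hc0|exact Hgauss]].
        apply Rle_trans with (2 / (3 * c3 * d) * / sqrt N * (q * g)).
        - replace (2 / (3 * c3 * d) * / sqrt N * (q * g)) with
            (2 * (q / (3 * c3 * d) * / sqrt N) * g) by (field; lra).
          apply Rmult_le_compat_r; lra.
        - apply Rmult_le_compat_l; [exact Hc0|]. apply Rmult_le_compat_r; nra. }
      unfold M2. nra.
Qed.

(** * Summation over j, uniformly in n *)

Theorem corollary1 (a : Z -> C) (alpha c3 c4 : R)
    (hA : assumptionA a alpha c3 c4) (hc3 : 0 < c3) :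
  exists M : R, 0 < M /\
    forall n : nat, (1 <= n)%nat ->
      (let right_terms := fun j : Z =>
         if Rle_dec 0 (IZR j - alpha * INR n)
         then Cmod (green a n j) else 0 in
       ex_Zseries right_terms /\ Zseries right_terms <= M) /\
      (let left_terms := fun j : Z =>
         if Rlt_dec (IZR j - alpha * INR n) 0
         then Cmod (green a n j - RtoC (approx_green alpha c3 c4 n j))%C else 0 in
       ex_Zseries left_terms /\ Zseries left_terms <= M).
Proof.
  destruct (green_right_profile a alpha c3 c4 hA hc3) as (Mr & HMr & Hr).
  destruct (green_left_profile a alpha c3 c4 hA hc3) as (Ml & HMl & Hl).
  (* 48 is the constant of the two summation lemmas; the added 1 makes the bound strictly
     positive. *)
  exists (48 * (Mr + Ml + 1)). split; [lra|].
  intros n Hn.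
  pose proof (cbrt_ge_1 n Hn) as Hv.
  assert (Hn1 : 1 <= INR n) by (apply (le_INR 1) in Hn; exact Hn).
  assert (Hs : 1 <= sqrt (INR n)) by (rewrite <- sqrt_1; apply sqrt_le_1_alt; lra).
  assert (Hinv : forall x, 1 <= x -> 0 < / x <= 1).
  { intros x Hx. split; [apply Rinv_0_lt_compat; lra|].
    rewrite <- Rinv_1. apply Rinv_le_contravar; lra. }
  pose proof (Hinv _ Hv) as He1. pose proof (Hinv _ Hs) as He2.
  split; cbv zeta.
  - match goal with |- ex_Zseries ?g /\ _ => set (f := g) end.
    destruct (Zseries_profile_right f (alpha * INR n) Mr _ _ He1 He2 HMr) as [E S];
      [| | |split; [exact E|lra]]; intros j; unfold f;
      destruct (Rle_dec 0 (IZR j - alpha * INR n)) as [Hx|Hx]; try lra; try apply Cmod_ge_0.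
    intros _. eapply Rle_trans; [now apply Hr|].
    apply Rmult_le_compat_l; [exact HMr|].
    pose proof (profile_nonneg (/ sqrt (INR n)) _ (proj1 He2) Hx). lra.
  - match goal with |- ex_Zseries ?g /\ _ => set (f := g) end.
    destruct (Zseries_profile_left f (alpha * INR n) Ml _ _ He1 He2 HMl) as [E S];
      [| | |split; [exact E|lra]]; intros j; unfold f;
      destruct (Rlt_dec (IZR j - alpha * INR n) 0) as [Hx|Hx]; try lra; try apply Cmod_ge_0.
    intros _. now apply Hl.
Qed.
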